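(* Let $m$ be a compactly supported Borel probability measure on $\mathbb{R}$, $\mathfrak{H}_0=L^2(\mathbb{R};m)$, $\mathfrak{H}_1=\mathbb{C}$. Let $A_0$ be the operator of multiplication by the independent variable on $\mathfrak{H}_0$, let $A_1$ be multiplication by a real number $a_1$ on $\mathfrak{H}_1$, and let $v\in\mathfrak{H}_0$ be a cyclic vector for $A_0$. Let $\omega$ be the finite positive compactly supported Borel measure on $\mathbb{R}$ determined by $$\int_{\mathbb{R}}\frac{d\omega(\lambda)}{\lambda-z}=\frac{1+(a_1-z)\langle v,(A_0-z)^{-1}v\rangle_{\mathfrak{H}_0}}{(a_1-z)-\langle v,(A_0-z)^{-1}v\rangle_{\mathfrak{H}_0}},\qquad z\in\mathbb{C}\setminus\mathbb{R}.$$ Then the sets $$S_{\mathrm{s}}=\Big\{\lambda\in\mathbb{R}: a_1-\lambda=\int\frac{|v(\mu)|^2dm(\mu)}{\mu-\lambda-\mathrm{i}0}\Big\}$$ and $$S_{\mathrm{sc}}=\Big\{\lambda\in\mathbb{R}: a_1-\lambda=\int\frac{|v(\mu)|^2dm(\mu)}{\mu-\lambda-\mathrm{i}0},\ \int\frac{|v(\mu)|^2dm(\mu)}{|\mu-\lambda|^2}=\infty\Big\}$$ are minimal supports of the singular part $\omega_{\mathrm{s}}$ and of the singularly continuous part $\omega_{\mathrm{sc}}$ of $\omega$, respectively. The set $$S_{\mathrm{pp}}=\Big\{\lambda\in\mathbb{R}: a_1-\lambda=\int\frac{|v(\mu)|^2dm(\mu)}{\mu-\lambda},\ \int\frac{|v(\mu)|^2dm(\mu)}{|\mu-\lambda|^2}<\infty\Big\}$$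 coincides with the set of all atoms of the measure $\omega$.
   Context: Inner products are linear in the second argument. A vector $v$ is cyclic for $A_0$ if the closed linear span of $\{A_0^nv:n\ge0\}$ is $\mathfrak{H}_0$. Notation: $\int\frac{f(\mu)\,dm(\mu)}{\mu-\lambda-\mathrm{i}0}:=\lim_{\varepsilon\to+0}\int\frac{f(\mu)\,dm(\mu)}{\mu-\lambda-\mathrm{i}\varepsilon}$; an equation involving this expression includes the requirement that the limit exists finitely. In $\int |v(\mu)|^2|\mu-\lambda|^{-2}dm(\mu)$ the factor $|\mu-\lambda|^{-2}$ equals $+\infty$ at $\mu=\lambda$ (with $0\cdot\infty=0$). The measure $\omega$ can be given explicitly as $\omega(\delta)=\langle v\oplus0,\mathsf{E}_{\mathbf{B}}(\delta)(v\oplus0)\rangle+\langle0\oplus1,\mathsf{E}_{\mathbf{B}}(\delta)(0\oplus1)\rangle$ for Borel sets $\delta$, where $\mathsf{E}_{\mathbf{B}}$ is the spectral measure of the bounded self-adjoint operator $\mathbf{B}=\begin{pmatrix} A_0 & V \\ V^* & A_1 \end{pmatrix}$ on $\mathfrak{H}_0\oplus\mathfrak{H}_1$, with $V:\mathbb{C}\to\mathfrak{H}_0$, $Vc=cv$. The singular and singularly continuous parts refer to the Lebesgue decomposition of $\omega$ with respect to Lebesgue measure ($\omega_{\mathrm{sc}}$ is $\omega_{\mathrm{s}}$ with its atoms removed). A measurable, not necessarily closed, set $S\subset\mathbb{R}$ is a support of a measure $\nu$ if $\nu(\mathbb{R}\setminus S)=0$. A support $S$ is minimal if every measurable subset $S'\subset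 S$ with $\nu(S')=0$ has Lebesgue measure zero. *)

(* Defs.v *)
From HB Require Import structures.
From mathcomp Require Import all_boot all_order all_algebra complex.
From mathcomp Require Import all_classical all_reals all_analysis.
Import Order.TTheory GRing.Theory Num.Theory numFieldNormedType.Exports.
Import ComplexField.Normc.

Set Implicit Arguments.
Unset Strict Implicit.
Unset Printing Implicit Defensive.

Local Open Scope classical_set_scope.
Local Open Scope ring_scope.

Section L2.
Context {R : realType}.
Implicit Types m : {measure set (measurableTypeR R) -> \bar R}.
Implicit Types f g : R -> R[i].

Definition compactly_supported m : Prop :=
  exists2 K : set R, compact K & m (~` K) = 0%E.

(* Integral of a complex function, componentwise; [Rintegral] is a total
   function, so this is meaningful only for integrable integrands. *)
Definition cintegral m f : R[i] :=
  ((\int[m]_x complex.Re (f x)) +i* (\int[m]_x complex.Im (f x)))%C.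

Definition cmeasurable f : Prop :=
  measurable_fun setT (fun x => complex.Re (f x) : R) /\
  measurable_fun setT (fun x => complex.Im (f x) : R).

Definition L2norm m f : \bar R := ('N[m]_2%:E[(fun x => (normc (f x))%:E)])%E.

(* The elements of L^2(R; m) are represented by functions; those that agree
   m-almost everywhere represent the same element. *)
Definition L2 m f : Prop := cmeasurable f /\ (L2norm m f < +oo)%E.

Definition L2inner m f g : R[i] := cintegral m (fun x => (f x)^*%C * g x).

Definition mulX f : R -> R[i] := fun x => x%:C%C * f x.

(* (A_0 - z)^-1 for the multiplication operator A_0 = [mulX] and z not real *)
Definition resolvent (z : R[i]) f : R -> R[i] := fun x => (x%:C%C - z)^-1 * f x.

Lemma subz_neq0 (z : R[i]) (x : R) : complex.Im z != 0 -> x%:C%C - z != 0.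
Proof.
apply: contra; rewrite subr_eq0 => /eqP <- /=; exact: eqxx.
Qed.

Lemma resolventK (z : R[i]) f : complex.Im z != 0 ->
  (fun x => mulX (resolvent z f) x - z * resolvent z f x) = f.
Proof.
move=> z0; apply/funext => x.
by rewrite /mulX -mulrBl mulrA divff ?mul1r// subz_neq0.
Qed.

Lemma resolventVK (z : R[i]) f : complex.Im z != 0 ->
  resolvent z (fun x => mulX f x - z * f x) = f.
Proof.
move=> z0; apply/funext => x.
by rewrite /resolvent /mulX -mulrBl mulrA mulVf ?mul1r// subz_neq0.
Qed.

Definition linear_span (G : set (R -> R[i])) : set (R -> R[i]) :=
  [set g | exists (n : nat) (c : 'I_n -> R[i]) (h : 'I_n -> R -> R[i]),
    (forall k, G (h k)) /\ g = fun x => \sum_(k < n) c k * h k x].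

Definition L2closure m (G : set (R -> R[i])) : set (R -> R[i]) :=
  [set f | L2 m f /\ forall e : R, 0 < e ->
    exists2 g, G g & (L2norm m (fun x => (f x - g x)%R) < e%:E)%E].

Definition cyclic_vector m (v : R -> R[i]) : Prop :=
  L2closure m (linear_span [set iter n mulX v | n in setT]) = L2 m.

End L2.

Section singular_parts.
Context {R : realType}.
Implicit Types (nu : set (measurableTypeR R) -> \bar R) (S : set R).

Definition atoms nu : set R := [set x | nu [set x] != 0%E].

Definition lebesgue_decomposition
    (mu mu_ac mu_s : {measure set (measurableTypeR R) -> \bar R}) : Prop :=
  [/\ forall B, measurable B -> mu B = (mu_ac B + mu_s B)%E,
      mu_ac `<< lebesgue_measure
    & exists N, [/\ measurable N, lebesgue_measure N = 0%E
                  & mu_s (~` N) = 0%E]].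

Definition remove_atoms nu : set (measurableTypeR R) -> \bar R :=
  fun B => nu (B `\` atoms nu).

Definition is_support nu S : Prop :=
  measurable (S : set (measurableTypeR R)) /\ nu (~` S) = 0%E.

(* "Measurable" is Borel measurable throughout. *)
Definition minimal_support nu S : Prop :=
  is_support nu S /\
  forall S' : set R, measurable (S' : set (measurableTypeR R)) -> S' `<=` S ->
    nu S' = 0%E -> lebesgue_measure S' = 0%E.

End singular_parts.

Section supports.
Context {R : realType}.
Implicit Types (m : {measure set (measurableTypeR R) -> \bar R}) (a l : R).
Implicit Types v : R -> R[i].

(* \int |v(x)|^2 dm(x) / (x - l - i0) exists finitely and equals c *)
Definition boundary_integral_eq m v l (c : R[i]) : Prop :=
  cintegral m (fun x => (normc (v x) ^+ 2)%:C%C / (x%:C%C - (l +i* e)%C))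
    @[e --> 0^'+] --> (c : R[i]^o).

(* 0^-1 = +oo and 0 * +oo = 0 in [\bar R] *)
Definition square_integral m v l : \bar R :=
  (\int[m]_x ((normc (v x) ^+ 2)%:E * (`|x - l| ^+ 2)%:E^-1))%E.

Definition S_s m v a : set R :=
  [set l | boundary_integral_eq m v l (a - l)%:C%C].

Definition S_sc m v a : set R :=
  [set l | boundary_integral_eq m v l (a - l)%:C%C /\
           square_integral m v l = +oo%E].

(* The extended-real integral equals a finite value only if it converges
   absolutely. Its integrand is 0 at x = l, which is harmless: finiteness of
   the second integral makes |v|^2 m vanish on {l}. *)
Definition S_pp m v a : set R :=
  [set l | (\int[m]_x (normc (v x) ^+ 2 / (x - l))%:E)%E = (a - l)%:E /\
           (square_integral m v l < +oo)%E].

End supports.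

(* Main.v *)
Require Import Defs.
From HB Require Import structures.
From mathcomp Require Import all_boot all_order all_algebra complex.
From mathcomp Require Import all_classical all_reals all_analysis.
From mathcomp Require Import measurable_realfun ring lra.
Import Order.TTheory GRing.Theory Num.Theory numFieldNormedType.Exports.
Import ComplexField.Normc.

(* Write F for the Stieltjes transform of |v|^2 m, Om for that of omega and
   G = a1 - z.  The relation Om = (1 + G F) / (G - F) inverts to
   (F - G) (Om + G) = - (1 + G^2), so F(l + i0) = a1 - l exactly when
   |Om(l + ie)| -> oo.  Such l carry omega_s, because at omega_s-almost every
   point the dyadic densities of omega tend to infinity and Im Om dominates
   them; they form a Lebesgue null set, because Om / (Om + it) is a bounded
   analytic function of nonnegative real part whose Poisson mean is O(1/t),
   uniformly in e.  This mean value property is obtained without contour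
   integrals: on the line Im z = e the function is a uniform limit of
   polynomials in the Cayley variable W = (1 + ix) / (1 - ix) = exp(2i atan x),
   and the powers W^n, n > 0, have Poisson mean 0.
   If s = \int |v|^2 / |x - l|^2 dm is finite then F(l + ie) = F(l) + O(e), which
   bounds e |Om(l + ie)| from below when F(l) = a1 - l; conversely an atom at l
   makes Im Om(l + ie) at least of order 1/e, and the relation above then bounds
   Im F(l + ie) / e, whose supremum is s. *)

Set Implicit Arguments.
Unset Strict Implicit.
Unset Printing Implicit Defensive.

Local Open Scope classical_set_scope.
Local Open Scope ring_scope.

(** The inverted relation is useful because, for fixed [l] and small [Im z], the factor [1 + G^2]
    stays between two positive constants: its zeros are [G = i] and [G = -i], while G is close to
    the real number [a1 - l]. Thus [F - G] is small exactly when [Om + G] is large, with explicit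
    rates, and the same rates decide about atoms. Minimality reduces to nullity: [S_s] is Lebesgue
    null, hence so is each of its subsets. The substantial claim is that [omega_s] lives on [S_s],
    which requires comparing an arbitrary finite measure with Lebesgue measure at small scales.
    Dyadic cells permit this for any measure, since two cells are either nested or disjoint and a
    covering can be thinned to a disjoint one without loss. The work is done on lines [Im z = e]
    with [e > 0], where the transform is Lipschitz and the pole of the kernel stays outside the
    closed disc of the Cayley variable; only bounds independent of [e] are carried to the limit. *)

Local Notation Re := complex.Re.
Local Notation Im := complex.Im.

(** * Complex modulus and complex integrals *)

Section normc_theory.
Context {R : rcfType}.
Implicit Types z w : R[i].

Lemma normc_sqrtE z : normc z = Num.sqrt (Re z ^+ 2 + Im z ^+ 2).
Proof. by case: z. Qed.

Lemma normc_ge0 z : 0 <= normc z.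
Proof. by rewrite normc_sqrtE sqrtr_ge0. Qed.

Lemma sqr_normcE z : normc z ^+ 2 = Re z ^+ 2 + Im z ^+ 2.
Proof. by rewrite normc_sqrtE sqr_sqrtr// addr_ge0// sqr_ge0. Qed.

Lemma ler_normcD z w : normc (z + w) <= normc z + normc w.
Proof. exact: le_normcD. Qed.

Lemma normc_opp z : normc (- z) = normc z.
Proof. exact: normcN. Qed.

Lemma normc_distC z w : normc (z - w) = normc (w - z).
Proof. by rewrite -normc_opp opprB. Qed.

Lemma normcX z n : normc (z ^+ n) = normc z ^+ n.
Proof. by elim: n => [|n IH]; rewrite ?expr0 ?normc1// !exprS normcM IH. Qed.

Lemma normc_real (x : R) : normc x%:C%C = `|x|.
Proof. by rewrite normc_sqrtE/= expr0n addr0 sqrtr_sqr. Qed.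

Lemma normc_eq0 z : (normc z == 0) = (z == 0).
Proof. by apply/eqP/eqP => [/eq0_normc//|->]; exact: normc0. Qed.

Lemma normc_gt0 z : (0 < normc z) = (z != 0).
Proof. by rewrite lt_def normc_ge0 andbT normc_eq0. Qed.

Lemma ler_Re_normc z : `|Re z| <= normc z.
Proof. by rewrite normc_sqrtE -sqrtr_sqr ler_wsqrtr// lerDl sqr_ge0. Qed.

Lemma ler_Im_normc z : `|Im z| <= normc z.
Proof. by rewrite normc_sqrtE -sqrtr_sqr ler_wsqrtr// lerDr sqr_ge0. Qed.

Lemma normc_le_ReIm z : normc z <= `|Re z| + `|Im z|.
Proof.
rewrite normc_sqrtE -[leRHS](ger0_norm) ?addr_ge0//.
rewrite -[leRHS]sqrtr_sqr ler_wsqrtr// sqrrD !real_normK ?num_real// lerD2r lerDl mulrn_wge0// mulr_ge0.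
Qed.

Lemma ler_sub_normc z w : normc z - normc w <= normc (z - w).
Proof. by rewrite lerBlDr -{1}(subrK w z) ler_normcD. Qed.

Lemma Im_neq0 z : Im z != 0 -> z != 0.
Proof. by apply: contra => /eqP ->. Qed.

Lemma ReMc z w : Re (z * w) = Re z * Re w - Im z * Im w.
Proof. by case: z => a b; case: w => c d. Qed.

Lemma ImMc z w : Im (z * w) = Re z * Im w + Im z * Re w.
Proof. by case: z => a b; case: w => c d. Qed.

Lemma ReDc z w : Re (z + w) = Re z + Re w.
Proof. by case: z => a b; case: w => c d. Qed.

Lemma ImDc z w : Im (z + w) = Im z + Im w.
Proof. by case: z => a b; case: w => c d. Qed.

Lemma ReNc z : Re (- z) = - Re z.
Proof. by case: z. Qed.

Lemma ImNc z : Im (- z) = - Im z.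
Proof. by case: z. Qed.

Lemma ReVc z : Re z^-1 = Re z / normc z ^+ 2.
Proof. by rewrite sqr_normcE; case: z. Qed.

Lemma ImVc z : Im z^-1 = - Im z / normc z ^+ 2.
Proof. by rewrite sqr_normcE; case: z => a b /=; rewrite mulNr. Qed.

Lemma complex_eqP z w : Re z = Re w -> Im z = Im w -> z = w.
Proof. by case: z => a b; case: w => c d /= -> ->. Qed.

End normc_theory.

Section cintegral_theory.
Context {R : realType}.
Variable m : {measure set (measurableTypeR R) -> \bar R}.
Implicit Types f g : R -> R[i].

Definition cintegrable f :=
  m.-integrable setT (EFin \o (fun x => Re (f x))) /\
  m.-integrable setT (EFin \o (fun x => Im (f x))).

Lemma cintegrable_normc_le f (g : R -> R) : cmeasurable f ->
  m.-integrable setT (EFin \o g) -> (forall x, normc (f x) <= g x) ->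
  cintegrable f.
Proof.
move=> [mr mi] ig fg; split.
- apply: (le_integrable measurableT _ _ ig); first exact/measurable_EFinP.
  move=> x _ /=; rewrite lee_fin; apply: (le_trans (ler_Re_normc _)).
  exact: (le_trans (fg x) (ler_norm _)).
- apply: (le_integrable measurableT _ _ ig); first exact/measurable_EFinP.
  move=> x _ /=; rewrite lee_fin; apply: (le_trans (ler_Im_normc _)).
  exact: (le_trans (fg x) (ler_norm _)).
Qed.

Lemma eq_cintegral f g : f =1 g -> cintegral m f = cintegral m g.
Proof. by move=> fg; have -> : f = g by exact/funext. Qed.

Lemma cintegrableD f g : cintegrable f -> cintegrable g ->
  cintegrable (fun x => f x + g x).
Proof.
move=> [fr fi] [gr gi]; split.
- rewrite (_ : _ \o _ = (EFin \o (fun x => Re (f x))) \+ (EFin \o (fun x => Re (g x))))%E.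
    exact: integrableD.
  by apply/funext => x /=; rewrite ReDc.
- rewrite (_ : _ \o _ = (EFin \o (fun x => Im (f x))) \+ (EFin \o (fun x => Im (g x))))%E.
    exact: integrableD.
  by apply/funext => x /=; rewrite ImDc.
Qed.

Lemma cintegralD f g : cintegrable f -> cintegrable g ->
  cintegral m (fun x => f x + g x) = cintegral m f + cintegral m g.
Proof.
move=> [fr fi] [gr gi]; apply: complex_eqP; rewrite ?ReDc ?ImDc /=.
- by rewrite -RintegralD//; apply: eq_Rintegral => x _; rewrite ReDc.
- by rewrite -RintegralD//; apply: eq_Rintegral => x _; rewrite ImDc.
Qed.

Lemma integrable_lincomb (a b : R) (f g : R -> R) :
  m.-integrable setT (EFin \o f) -> m.-integrable setT (EFin \o g) ->
  m.-integrable setT (EFin \o (fun x => a * f x + b * g x)).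
Proof.
move=> fi gi.
rewrite (_ : _ \o _ = (fun x => a%:E * (EFin \o f) x) \+ (fun x => b%:E * (EFin \o g) x))%E//.
by apply: integrableD => //; exact: integrableZl.
Qed.

Lemma Rintegral_lincomb (a b : R) (f g : R -> R) :
  m.-integrable setT (EFin \o f) -> m.-integrable setT (EFin \o g) ->
  \int[m]_x (a * f x + b * g x) = a * \int[m]_x f x + b * \int[m]_x g x.
Proof.
move=> fi gi; rewrite RintegralD ?RintegralZl//.
- by rewrite (_ : _ \o _ = (fun x => a%:E * (EFin \o f) x)%E)//; exact: integrableZl.
- by rewrite (_ : _ \o _ = (fun x => b%:E * (EFin \o g) x)%E)//; exact: integrableZl.
Qed.

Lemma cintegrableZ (c : R[i]) f : cintegrable f -> cintegrable (fun x => c * f x).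
Proof.
move=> [fr fi]; split.
- have := integrable_lincomb (Re c) (- Im c) fr fi.
  by apply: eq_integrable => // x _ /=; rewrite ReMc mulNr.
- have := integrable_lincomb (Re c) (Im c) fi fr.
  by apply: eq_integrable => // x _ /=; rewrite ImMc.
Qed.

Lemma cintegralZ (c : R[i]) f : cintegrable f ->
  cintegral m (fun x => c * f x) = c * cintegral m f.
Proof.
move=> [fr fi]; apply: complex_eqP; rewrite ?ReMc ?ImMc /=.
- by rewrite -mulNr -Rintegral_lincomb//; apply: eq_Rintegral => x _; rewrite ReMc mulNr.
- by rewrite -Rintegral_lincomb//; apply: eq_Rintegral => x _; rewrite ImMc.
Qed.

Lemma cintegralB f g : cintegrable f -> cintegrable g ->
  cintegral m (fun x => f x - g x) = cintegral m f - cintegral m g.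
Proof.
move=> fi gi.
rewrite (@eq_cintegral _ (fun x => f x + (-1) * g x)); last first.
  by move=> x; rewrite mulN1r.
by rewrite cintegralD ?cintegralZ ?mulN1r//; exact: cintegrableZ.
Qed.

Lemma cintegrable0 : cintegrable (fun=> 0).
Proof. by split; apply: eq_integrable (integrable0 _ _). Qed.

Lemma cintegral0 : cintegral m (fun=> 0) = 0.
Proof. by rewrite /cintegral /Rintegral /= integral0. Qed.

Lemma cintegrable_sum n (f : nat -> R -> R[i]) : (forall k, cintegrable (f k)) ->
  cintegrable (fun x => \sum_(k < n) f k x).
Proof.
move=> fi; elim: n => [|n IH].
  rewrite (_ : (fun x => _) = fun=> 0); first exact: cintegrable0.
  by apply/funext => x; rewrite big_ord0.
rewrite (_ : (fun x => _) = fun x => \sum_(k < n) f k x + f n x).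
  exact: cintegrableD.
by apply/funext => x; rewrite big_ord_recr.
Qed.

Lemma cintegral_sum n (f : nat -> R -> R[i]) : (forall k, cintegrable (f k)) ->
  cintegral m (fun x => \sum_(k < n) f k x) = \sum_(k < n) cintegral m (f k).
Proof.
move=> fi; elim: n => [|n IH].
  rewrite big_ord0 -[RHS]cintegral0; apply: eq_cintegral => x.
  by rewrite big_ord0.
rewrite big_ord_recr/= -IH -cintegralD//; last exact: cintegrable_sum.
by apply: eq_cintegral => x; rewrite big_ord_recr.
Qed.

(** The factor 2 pays for estimating real and imaginary parts separately; it recurs below, where
    constant factors are harmless. *)
Lemma normc_cintegral_le f (g : R -> R) : cintegrable f ->
  m.-integrable setT (EFin \o g) -> (forall x, normc (f x) <= g x) ->
  normc (cintegral m f) <= 2 * \int[m]_x g x.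
Proof.
move=> [fr fi] ig fg; apply: (le_trans (normc_le_ReIm _)) => /=.
rewrite mulr_natl mulr2n; apply: lerD.
- apply: (le_trans (le_normr_Rintegral measurableT fr)).
  apply: le_Rintegral => //; first exact: integrable_norm.
  by move=> x _; apply: (le_trans (ler_Re_normc _)).
- apply: (le_trans (le_normr_Rintegral measurableT fi)).
  apply: le_Rintegral => //; first exact: integrable_norm.
  by move=> x _; apply: (le_trans (ler_Im_normc _)).
Qed.

End cintegral_theory.

(** * Stieltjes transforms *)

Section kernel.
Context {R : realType}.
Implicit Types (z : R[i]) (x y : R).

Lemma ReB_real x z : Re (x%:C%C - z) = x - Re z.
Proof. by case: z. Qed.

Lemma ImB_real x z : Im (x%:C%C - z) = - Im z.
Proof. by case: z => a b /=; rewrite sub0r. Qed.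

Lemma sqr_normcB_real x z :
  normc (x%:C%C - z) ^+ 2 = (x - Re z) ^+ 2 + Im z ^+ 2.
Proof. by rewrite sqr_normcE ReB_real ImB_real sqrrN. Qed.

Lemma Re_kernel x z :
  Re (x%:C%C - z)^-1 = (x - Re z) / ((x - Re z) ^+ 2 + Im z ^+ 2).
Proof. by rewrite ReVc sqr_normcB_real ReB_real. Qed.

Lemma Im_kernel x z :
  Im (x%:C%C - z)^-1 = Im z / ((x - Re z) ^+ 2 + Im z ^+ 2).
Proof. by rewrite ImVc sqr_normcB_real ImB_real opprK. Qed.

Lemma ReZ (a : R) z : Re (a%:C%C * z) = a * Re z.
Proof. by rewrite ReMc/= mul0r subr0. Qed.

Lemma ImZ (a : R) z : Im (a%:C%C * z) = a * Im z.
Proof. by rewrite ImMc/= mul0r addr0. Qed.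

Lemma normc_kernel_le x z : 0 < Im z -> normc (x%:C%C - z)^-1 <= (Im z)^-1.
Proof.
move=> z0; rewrite normcV lef_pV2 ?posrE//; last first.
  by rewrite normc_gt0 subz_neq0// gt_eqF.
apply: le_trans (ler_Im_normc _).
by rewrite ImB_real normrN ger0_norm// ltW.
Qed.

Lemma kernelB x z z' : Im z != 0 -> Im z' != 0 ->
  (x%:C%C - z)^-1 - (x%:C%C - z')^-1 =
  (z - z') * ((x%:C%C - z)^-1 * (x%:C%C - z')^-1).
Proof.
move=> z0 z'0; have := subz_neq0 x z0; have := subz_neq0 x z'0 => h h'.
by field; rewrite h h'.
Qed.

Lemma kernel_denom_gt0 (a b x : R) : b != 0 -> 0 < (x - a) ^+ 2 + b ^+ 2.
Proof. by move=> b0; rewrite ltr_wpDl ?sqr_ge0// exprn_even_gt0. Qed.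

Lemma continuous_kernel_denom (a b : R) :
  continuous (fun x : R => (x - a) ^+ 2 + b ^+ 2).
Proof.
move=> x; apply: cvgD; last exact: cvg_cst.
by apply: (@continuous_comp _ _ _ (fun x => x - a) (fun x => x ^+ 2));
  [apply: cvgB; [exact: cvg_id|exact: cvg_cst]|exact: exprn_continuous].
Qed.

Lemma measurable_Re_kernel z : Im z != 0 ->
  measurable_fun setT (fun x : R => Re (x%:C%C - z)^-1).
Proof.
move=> z0; apply: continuous_measurable_fun => x.
rewrite (_ : (fun _ => _) = (fun x : R => (x - Re z) / ((x - Re z) ^+ 2 + Im z ^+ 2))).
  apply: cvgM; first by apply: cvgB; [exact: cvg_id|exact: cvg_cst].
  by apply: cvgV; [rewrite gt_eqF// kernel_denom_gt0|exact: continuous_kernel_denom].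
by apply/funext => t; rewrite Re_kernel.
Qed.

Lemma measurable_Im_kernel z : Im z != 0 ->
  measurable_fun setT (fun x : R => Im (x%:C%C - z)^-1).
Proof.
move=> z0; apply: continuous_measurable_fun => x.
rewrite (_ : (fun _ => _) = (fun x : R => Im z / ((x - Re z) ^+ 2 + Im z ^+ 2))).
  apply: cvgM; first exact: cvg_cst.
  by apply: cvgV; [rewrite gt_eqF// kernel_denom_gt0|exact: continuous_kernel_denom].
by apply/funext => t; rewrite Im_kernel.
Qed.

Lemma cmeasurableM (f g : R -> R[i]) : cmeasurable f -> cmeasurable g ->
  cmeasurable (fun x => f x * g x).
Proof.
move=> [fr fi] [gr gi]; split.
- under eq_fun do rewrite ReMc.
  by apply: measurable_funB; exact: measurable_funM.
- under eq_fun do rewrite ImMc.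
  by apply: measurable_funD; exact: measurable_funM.
Qed.

Lemma cmeasurable_kernel z : Im z != 0 -> cmeasurable (fun x => (x%:C%C - z)^-1).
Proof.
by move=> z0; split; [exact: measurable_Re_kernel|exact: measurable_Im_kernel].
Qed.

End kernel.

Section stieltjes.
Context {R : realType}.
Variable m : {measure set (measurableTypeR R) -> \bar R}.
Variable w : R -> R.
Hypothesis w0 : forall x, 0 <= w x.
Hypothesis wi : m.-integrable setT (EFin \o w).
Implicit Types z : R[i].

(** The weight lets one definition serve both transforms: [w = |v|^2] over [m] gives F, and [w = 1]
    over [omega] gives Om. *)
Definition stieltjes z := cintegral m (fun x => (w x)%:C%C / (x%:C%C - z)).

Let wm : measurable_fun setT w.
Proof. by apply/measurable_EFinP; exact: (measurable_int m). Qed.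

Lemma cmeasurable_weight : cmeasurable (fun x => (w x)%:C%C).
Proof. by split => //=; exact: measurable_cst. Qed.

Lemma cintegrable_stieltjes z : 0 < Im z ->
  cintegrable m (fun x => (w x)%:C%C / (x%:C%C - z)).
Proof.
move=> z0; apply: (@cintegrable_normc_le _ _ _ (fun x => (Im z)^-1 * w x)).
- apply: cmeasurableM; first exact: cmeasurable_weight.
  by apply: cmeasurable_kernel; rewrite gt_eqF.
- exact: (integrableZl _ _ wi).
- move=> x; rewrite normcM normc_real ger0_norm// mulrC ler_wpM2r//.
  exact: normc_kernel_le.
Qed.

Definition mass := \int[m]_x w x.

Lemma mass_ge0 : 0 <= mass.
Proof. by apply: Rintegral_ge0 => x _; exact: w0. Qed.

Lemma normc_stieltjes_le z : 0 < Im z -> normc (stieltjes z) <= 2 * mass / Im z.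
Proof.
move=> z0; have h := cintegrable_stieltjes z0.
apply: (le_trans (normc_cintegral_le (g := fun x => (Im z)^-1 * w x) h _ _)).
- exact: (integrableZl _ _ wi).
- move=> x; rewrite normcM normc_real ger0_norm// mulrC ler_wpM2r//.
  exact: normc_kernel_le.
- by rewrite RintegralZl// -mulrA (mulrC mass).
Qed.

(** The resolvent identity [kernelB], then [normc_kernel_le] twice. Continuity of the transform
    along horizontal lines, and the measurability drawn from it, rest on this bound. *)
Lemma normc_stieltjesB_le z z' : 0 < Im z -> 0 < Im z' ->
  normc (stieltjes z - stieltjes z') <=
    2 * normc (z - z') * mass / (Im z * Im z').
Proof.
move=> z0 z'0; rewrite /stieltjes -cintegralB; try exact: cintegrable_stieltjes.
set g := fun x => (normc (z - z') / (Im z * Im z')) * w x.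
have fE x : (w x)%:C%C / (x%:C%C - z) - (w x)%:C%C / (x%:C%C - z') =
   (w x)%:C%C * ((z - z') * ((x%:C%C - z)^-1 * (x%:C%C - z')^-1)).
  by rewrite -mulrBr kernelB// gt_eqF.
have h : cintegrable m (fun x => (w x)%:C%C / (x%:C%C - z) - (w x)%:C%C / (x%:C%C - z')).
  under eq_fun do rewrite -(mulN1r (_ / _)).
  apply: cintegrableD; first exact: cintegrable_stieltjes.
  by apply: cintegrableZ; exact: cintegrable_stieltjes.
apply: (le_trans (normc_cintegral_le (g := g) h _ _)).
- exact: (integrableZl _ _ wi).
- move=> x; rewrite fE /g normcM normc_real ger0_norm// mulrC ler_wpM2r//.
  rewrite normcM ler_wpM2l ?normc_ge0// normcM invfM.
  by apply: ler_pM; rewrite ?normc_ge0// normc_kernel_le.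
- by rewrite /g RintegralZl// le_eqVlt; apply/orP; left; apply/eqP; rewrite /mass; ring.
Qed.

Lemma Im_stieltjes z : Im (stieltjes z) =
  \int[m]_x (w x * (Im z / ((x - Re z) ^+ 2 + Im z ^+ 2))).
Proof. by apply: eq_Rintegral => x _; rewrite ImZ Im_kernel. Qed.

Lemma Im_stieltjes_ge0 z : 0 < Im z -> 0 <= Im (stieltjes z).
Proof.
move=> z0; rewrite Im_stieltjes; apply: Rintegral_ge0 => x _.
by rewrite mulr_ge0// divr_ge0 ?ltW// kernel_denom_gt0// gt_eqF.
Qed.

End stieltjes.

(** * Mean value property for the disc algebra of the half-plane *)

Section poisson.
Context {R : realType}.
Notation mu := (@lebesgue_measure R).
Implicit Types (x : R).

(** The fundamental theorem of calculus on [[-n, n]], extended to the line by dominated convergence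
    with [|f|] as dominating function. *)
Lemma Rintegral_derive_line (F f : R -> R) (l : R) :
  (forall x, is_derive x (1 : R) F (f x)) -> continuous f ->
  mu.-integrable setT (EFin \o f) ->
  (F n%:R - F (- n%:R)) @[n --> \oo] --> l ->
  \int[mu]_x f x = l.
Proof.
move=> dF cf fi Fl.
have mf : measurable_fun setT f by exact: continuous_measurable_fun.
have Fc : continuous F.
  by move=> x; apply: differentiable_continuous; apply/derivable1_diffP; exact: ex_derive.
pose I n : set R := `[- n%:R, n%:R]%classic.
have Ir n : (\int[mu]_(x in I n.+1) (f x)%:E = (F n.+1%:R - F (- n.+1%:R))%:E)%E.
  rewrite (@continuous_FTC2 _ _ F).
  - by rewrite EFinB.
  - by rewrite gtrN// ltr0n.
  - exact: continuous_subspaceT.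
  - split.
    + by move=> x _; exact: ex_derive.
    + by apply: cvg_at_right_filter; exact: Fc.
    + by apply: cvg_at_left_filter; exact: Fc.
  - by move=> x _; rewrite derive1E; exact: derive_val.
have [||||| _ _ h] := @dominated_convergence _ _ _ mu setT measurableT
    (fun n x => ((f \_ (I n)) x)%:E) (EFin \o f) (fun x => `|f x|%:E).
  - move=> n; apply/measurable_EFinP.
    apply/(measurable_restrictT _ _).1; first exact: measurable_itv.
    exact: measurable_funTS.
  - exact/measurable_EFinP.
  - apply: aeW => x _; apply: cvg_near_cst; near=> n.
    rewrite patchE mem_set//=/I/= in_itv/= -ler_norml.
    near: n; exact: nbhs_infty_ger.
  - exact: (integrable_norm fi).
  - apply: aeW => x n _; rewrite lee_fin patchE; case: ifPn => // _.
    by rewrite normr0.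
have E : (\int[mu]_x (f x)%:E = l%:E)%E.
  move: h; rewrite -cvg_shiftS => /cvg_lim <- //; apply/cvg_lim => //.
  move: Fl; rewrite -cvg_shiftS => Fl.
  rewrite (_ : (fun n => _) = (fun n => (F n.+1%:R - F (- n.+1%:R))%:E)).
    by apply: cvg_EFin; [exact: nearW|exact: Fl].
  apply/funext => n /=; rewrite -Ir [RHS]integral_mkcond.
  by apply: eq_integral => x _; rewrite restrict_EFin.
by rewrite /Rintegral E.
Unshelve. all: by end_near. Qed.

End poisson.

(** * The Cayley variable and the Poisson means of its powers *)

Section cayley.
Context {R : realType}.
Notation mu := (@lebesgue_measure R).
Implicit Types (x : R).

(* Equal to (1 + ix) / (1 - ix), see [cayleyE]. *)
Definition cayley x : R[i] := (cos (2 * atan x) +i* sin (2 * atan x))%C.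

Lemma cayleyX x n :
  cayley x ^+ n = (cos ((2 * n)%:R * atan x) +i* sin ((2 * n)%:R * atan x))%C.
Proof.
elim: n => [|n IH]; first by rewrite expr0 muln0 mul0r cos0 sin0.
rewrite exprS IH /cayley mulnS (natrD _ 2) [(2%:R + _) * _]mulrDl.
rewrite (cosD (2%:R * _)) (sinD (2%:R * _)).
by apply: complex_eqP => /=; ring.
Qed.

Lemma normc_cayley x : normc (cayley x) = 1.
Proof. by rewrite /normc /cayley cos2Dsin2 sqrtr1. Qed.

Lemma cayleyE x : (1 -i* x)%C * cayley x = (1 +i* x)%C.
Proof.
have c0 : cos (atan x) != 0 by rewrite cos_atan invr_eq0 gt_eqF// sqrtr_gt0 ltr_pwDl// sqr_ge0.
have sE : sin (atan x) = x * cos (atan x).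
  by rewrite -{2}(atanK x) /tan divfK.
have c2 : cos (atan x) ^+ 2 * (1 + x ^+ 2) = 1.
  by rewrite -[RHS](cos2Dsin2 (atan x)) sE; ring.
have C2 : cos (2 * atan x) = 2 * cos (atan x) ^+ 2 - 1.
  by rewrite mulr_natl mulr2n cosD sE; lra.
have S2 : sin (2 * atan x) = 2 * x * cos (atan x) ^+ 2.
  by rewrite mulr_natl mulr2n sinD sE; ring.
by apply: complex_eqP => /=; rewrite C2 S2; nra.
Qed.

Lemma cmeasurable_cayleyX n : cmeasurable (fun x => cayley x ^+ n).
Proof.
have ca : continuous (fun x : R => (2 * n)%:R * atan x).
  by move=> x; apply: cvgM; [exact: cvg_cst|exact: continuous_atan].
split; apply: continuous_measurable_fun => x.
- rewrite (_ : (fun _ => _) = cos \o (fun x : R => (2 * n)%:R * atan x)).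
    by apply: continuous_comp; [exact: ca|exact: continuous_cos].
  by apply/funext => t /=; rewrite cayleyX.
- rewrite (_ : (fun _ => _) = sin \o (fun x : R => (2 * n)%:R * atan x)).
    by apply: continuous_comp; [exact: ca|exact: continuous_sin].
  by apply/funext => t /=; rewrite cayleyX.
Qed.

Lemma integral_oneDsqrV : (\int[mu]_x ((oneDsqr x)^-1)%:E = (pi : R)%:E)%E.
Proof.
rewrite ge0_symfun_integralT.
- have -> : [set x : R | 0 <= x] = `[0, +oo[%classic by rewrite set_itvE.
  by rewrite integral0y_oneDsqr -EFinM; congr EFin; field.
- by move=> x; rewrite invr_ge0 (le_trans ler01)// oneDsqr_ge1.
- exact: continuous_oneDsqrV.
- by move=> x /=; rewrite /oneDsqr sqrrN.
Qed.

Lemma oneDsqrV_ge0 x : 0 <= (oneDsqr x)^-1.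
Proof. by rewrite invr_ge0 (le_trans ler01)// oneDsqr_ge1. Qed.

Lemma integrable_oneDsqrV : mu.-integrable setT (EFin \o (fun x => (oneDsqr x)^-1)).
Proof.
apply/integrableP; split.
  by apply/measurable_EFinP; apply: continuous_measurable_fun; exact: continuous_oneDsqrV.
under eq_integral => x _ do rewrite /= ger0_norm ?oneDsqrV_ge0//.
by rewrite integral_oneDsqrV ltry.
Qed.

Lemma integrable_oneDsqrVM (h : R -> R) (M : R) : measurable_fun setT h ->
  (forall x, `|h x| <= M) ->
  mu.-integrable setT (EFin \o (fun x => (oneDsqr x)^-1 * h x)).
Proof.
move=> mh hM.
apply: (@le_integrable _ _ _ mu setT measurableT _ (fun x => (M%:E * ((oneDsqr x)^-1)%:E)%E)).
- apply/measurable_EFinP; apply: measurable_funM => //.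
  by apply: continuous_measurable_fun; exact: continuous_oneDsqrV.
- move=> x _ /=; rewrite lee_fin !normrM mulrC ler_wpM2r//.
  exact: (le_trans (hM x) (ler_norm _)).
- exact: (integrableZl _ _ integrable_oneDsqrV).
Qed.

(** With [theta = atan x] this is the integral of [cos (2 n theta)] over [(-pi/2, pi/2)]; the
    antiderivative [sin (2 n theta) / (2 n)] vanishes at both ends. *)
Lemma Rintegral_cos_atan n : (0 < n)%N ->
  \int[mu]_x ((oneDsqr x)^-1 * cos ((2 * n)%:R * atan x)) = 0.
Proof.
move=> n0; have k0 : (2 * n)%:R != 0 :> R by rewrite pnatr_eq0 muln_eq0 -lt0n.
pose F x : R := (2 * n)%:R^-1 * sin ((2 * n)%:R * atan x).
apply: (@Rintegral_derive_line _ F).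
- move=> x; rewrite /F.
  rewrite (_ : (fun _ => _) = (2 * n)%:R^-1 \*: (sin \o ((2 * n)%:R \*: atan))) //.
  apply: is_derive_eq.
  rewrite /= /GRing.scale/=/oneDsqr; move: k0 {F}; move: ((2 * n)%:R : R) => K K0.
  by field; rewrite K0 gt_eqF// ltr_pwDl// sqr_ge0.
- move=> x; apply: cvgM; first exact: continuous_oneDsqrV.
  apply: (@continuous_comp _ _ _ (fun x : R => (2 * n)%:R * atan x) cos).
    by apply: cvgM; [exact: cvg_cst|exact: continuous_atan].
  exact: continuous_cos.
- apply: (@integrable_oneDsqrVM (fun x => cos ((2 * n)%:R * atan x)) 1).
    apply: continuous_measurable_fun => x.
    apply: (@continuous_comp _ _ _ (fun x : R => (2 * n)%:R * atan x) cos).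
      by apply: cvgM; [exact: cvg_cst|exact: continuous_atan].
    exact: continuous_cos.
  by move=> x; rewrite ler_norml cos_geN1 cos_le1.
- have -> : (fun k : nat => F k%:R - F (- k%:R)) =
     (fun k : nat => 2 * (2 * n)%:R^-1 * sin ((2 * n)%:R * atan k%:R)).
    by apply/funext => k; rewrite /F atanN mulrN sinN; ring.
  have -> : 0 = 2 * (2 * n)%:R^-1 * sin ((2 * n)%:R * (pi / 2)) :> R.
    have -> : (2 * n)%:R * (pi / 2) = pi *+ n :> R by rewrite natrM -mulr_natl; field.
    have -> : sin (pi *+ n) = 0 :> R.
      by elim: (n) => [|k IH]; rewrite ?mulr0n ?sin0// mulrSr sinDpi IH oppr0.
    by rewrite mulr0.
  apply: cvgM; first exact: cvg_cst.
  apply: (@cvg_comp _ _ _ (fun k : nat => (2 * n)%:R * atan k%:R : R) sin _ (nbhs ((2 * n)%:R * (pi / 2))));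
    last exact: continuous_sin.
  apply: cvgM; first exact: cvg_cst.
  by apply: cvg_comp (@cvgy_atan R); exact: cvgr_idn.
Qed.

(** Here the antiderivative is even in [x], so its increment over a symmetric interval is zero even
    before the limit. *)
Lemma Rintegral_sin_atan n : (0 < n)%N ->
  \int[mu]_x ((oneDsqr x)^-1 * sin ((2 * n)%:R * atan x)) = 0.
Proof.
move=> n0; have k0 : (2 * n)%:R != 0 :> R by rewrite pnatr_eq0 muln_eq0 -lt0n.
pose F x : R := - (2 * n)%:R^-1 * cos ((2 * n)%:R * atan x).
apply: (@Rintegral_derive_line _ F).
- move=> x; rewrite /F.
  rewrite (_ : (fun _ => _) = (- (2 * n)%:R^-1) \*: (cos \o ((2 * n)%:R \*: atan))) //.
  apply: is_derive_eq.
  rewrite /= /GRing.scale/=/oneDsqr; move: k0 {F}; move: ((2 * n)%:R : R) => K K0.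
  by field; rewrite K0 gt_eqF// ltr_pwDl// sqr_ge0.
- move=> x; apply: cvgM; first exact: continuous_oneDsqrV.
  apply: (@continuous_comp _ _ _ (fun x : R => (2 * n)%:R * atan x) sin).
    by apply: cvgM; [exact: cvg_cst|exact: continuous_atan].
  exact: continuous_sin.
- apply: (@integrable_oneDsqrVM (fun x => sin ((2 * n)%:R * atan x)) 1).
    apply: continuous_measurable_fun => x.
    apply: (@continuous_comp _ _ _ (fun x : R => (2 * n)%:R * atan x) sin).
      by apply: cvgM; [exact: cvg_cst|exact: continuous_atan].
    exact: continuous_sin.
  by move=> x; rewrite ler_norml sin_geN1 sin_le1.
- have -> : (fun k : nat => F k%:R - F (- k%:R)) = (fun=> 0).
    by apply/funext => k; rewrite /F atanN mulrN cosN subrr.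
  exact: cvg_cst.
Qed.

End cayley.

(** * Poisson means and uniform limits of polynomials in the Cayley variable *)

Section disc_algebra.
Context {R : realType}.
Notation mu := (@lebesgue_measure R).
Implicit Types (f g h : R -> R[i]) (c d : R[i]).

(** The Poisson integral at the point i without its factor [1 / pi], whence the [pi] in the formulas
    below. *)
Definition poisson_mean f : R[i] :=
  cintegral mu (fun x => ((oneDsqr x)^-1)%:C%C * f x).

Lemma cintegrable_poisson f (M : R) : cmeasurable f ->
  (forall x, normc (f x) <= M) ->
  cintegrable mu (fun x => ((oneDsqr x)^-1)%:C%C * f x).
Proof.
move=> mf fM; apply: (@cintegrable_normc_le _ _ _ (fun x => M * (oneDsqr x)^-1)).
- apply: cmeasurableM => //; split => /=; last exact: measurable_cst.
  by apply: continuous_measurable_fun; exact: continuous_oneDsqrV.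
- exact: (integrableZl _ _ integrable_oneDsqrV).
- move=> x; rewrite normcM normc_real ger0_norm ?oneDsqrV_ge0// mulrC.
  by rewrite ler_wpM2r// oneDsqrV_ge0.
Qed.

Lemma poisson_mean_cayleyX n :
  poisson_mean (fun x => cayley x ^+ n) = (n == 0%N)%:R * pi%:C%C.
Proof.
apply: complex_eqP; rewrite /poisson_mean /=.
- under eq_Rintegral => x _ do rewrite ReZ cayleyX/=.
  case: n => [|n]; last by rewrite Rintegral_cos_atan// mul0r.
  rewrite mul1r /=; under eq_Rintegral => x _ do rewrite muln0 mul0r cos0 mulr1.
  by rewrite /Rintegral integral_oneDsqrV.
- under eq_Rintegral => x _ do rewrite ImZ cayleyX/=.
  case: n => [|n]; last by rewrite Rintegral_sin_atan// mul0r.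
  rewrite mul1r /=; under eq_Rintegral => x _ do rewrite muln0 mul0r sin0 mulr0.
  by rewrite Rintegral_cst// mul0r.
Qed.

Lemma cmeasurable_sum n (f : nat -> R -> R[i]) : (forall k, cmeasurable (f k)) ->
  cmeasurable (fun x => \sum_(k < n) f k x).
Proof.
move=> mf; elim: n => [|n [IHr IHi]].
  under eq_fun do rewrite big_ord0.
  by split; exact: measurable_cst.
under eq_fun do rewrite big_ord_recr.
have [fr fi] := mf n.
split.
- by under eq_fun do rewrite ReDc; exact: measurable_funD.
- by under eq_fun do rewrite ImDc; exact: measurable_funD.
Qed.

Lemma cmeasurable_cst c : cmeasurable (fun=> c : R[i]).
Proof. by split; exact: measurable_cst. Qed.

Lemma cmeasurable_horner_cayley (p : {poly R[i]}) :
  cmeasurable (fun x => p.[cayley x]).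
Proof.
under eq_fun do rewrite horner_coef.
apply: (@cmeasurable_sum _ (fun k x => p`_k * cayley x ^+ k)) => k.
by apply: cmeasurableM; [exact: cmeasurable_cst|exact: cmeasurable_cayleyX].
Qed.

(** The Cayley map sends i to 0, so [p.[0]] is the value at i of the analytic extension: only the
    constant term survives integration. *)
Lemma poisson_mean_horner (p : {poly R[i]}) :
  poisson_mean (fun x => p.[cayley x]) = pi%:C%C * p.[0].
Proof.
have h k : cintegrable mu (fun x => ((oneDsqr x)^-1)%:C%C * cayley x ^+ k).
  apply: (@cintegrable_poisson _ 1); first exact: cmeasurable_cayleyX.
  by move=> x; rewrite normcX normc_cayley expr1n.
rewrite /poisson_mean.
rewrite (@eq_cintegral _ _ _ (fun x => \sum_(k < size p)
   p`_k * (((oneDsqr x)^-1)%:C%C * cayley x ^+ k))); last first.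
  move=> x; rewrite horner_coef mulr_sumr; apply: eq_bigr => k _.
  by rewrite mulrCA.
rewrite (@cintegral_sum _ _ _ (fun k x => p`_k * (((oneDsqr x)^-1)%:C%C * cayley x ^+ k))); last first.
  by move=> k; exact: cintegrableZ.
rewrite horner_coef mulr_sumr; apply: eq_bigr => k _.
rewrite cintegralZ// -/(poisson_mean _) poisson_mean_cayleyX expr0n.
by rewrite mulrA mulrC.
Qed.

Lemma horner_bounded (p : {poly R[i]}) :
  exists2 M : R, 0 <= M & forall z, normc z <= 1 -> normc p.[z] <= M.
Proof.
elim/poly_ind: p => [|p c [M M0 IH]].
  by exists 0 => // z _; rewrite horner0 normc0.
exists (M + normc c); first by rewrite addr_ge0// normc_ge0.
move=> z z1; rewrite !hornerE; apply: (le_trans (ler_normcD _ _)).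
rewrite lerD2r normcM -[M]mulr1.
by apply: ler_pM; rewrite ?normc_ge0//; exact: IH.
Qed.

(* Uniform limits of polynomials in the Cayley variable: the boundary values on
   the real line of the functions in the disc algebra of the upper half-plane;
   [c] is the value of the analytic extension at the point i. *)
Definition disc_algebra f c : Prop := forall e : R, 0 < e ->
  exists p : {poly R[i]},
    (forall x, normc (f x - p.[cayley x]) <= e) /\ normc (c - p.[0]) <= e.

Lemma disc_algebra_lim f c :
  (forall e : R, 0 < e -> exists g d, [/\ disc_algebra g d,
     forall x, normc (f x - g x) <= e & normc (c - d) <= e]) ->
  disc_algebra f c.
Proof.
move=> H e e0; have e20 : 0 < e / 2 by rewrite divr_gt0.
have [g [d [gd fg cd]]] := H _ e20.
have [p [gp dp]] := gd _ e20.
exists p; split => [x|].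
  rewrite -(subrKA (g x)) (le_trans (ler_normcD _ _))// [leRHS]splitr.
  exact: lerD.
rewrite -(subrKA d) (le_trans (ler_normcD _ _))// [leRHS]splitr.
exact: lerD.
Qed.

Lemma disc_algebra_cst c : disc_algebra (fun=> c) c.
Proof.
move=> e e0; exists c%:P; split => [x|]; by rewrite hornerC subrr normc0 ltW.
Qed.

Lemma disc_algebraD f g c d : disc_algebra f c -> disc_algebra g d ->
  disc_algebra (fun x => f x + g x) (c + d).
Proof.
move=> fc gd e e0; have e20 : 0 < e / 2 by rewrite divr_gt0.
have [p [fp cp]] := fc _ e20; have [q [gq dq]] := gd _ e20.
have D (a b a' b' : R[i]) : a + b - (a' + b') = (a - a') + (b - b') by ring.
exists (p + q); split => [x|]; rewrite hornerD D (le_trans (ler_normcD _ _))//.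
- by rewrite [leRHS]splitr; exact: lerD.
- by rewrite [leRHS]splitr; exact: lerD.
Qed.

Lemma disc_algebra_bounded f c : disc_algebra f c ->
  exists2 M : R, 0 < M & (forall x, normc (f x) <= M) /\ normc c <= M.
Proof.
move=> /(_ _ ltr01)[p [fp cp]]; have [M M0 pM] := horner_bounded p.
exists (1 + M); first by rewrite ltr_pwDl.
split => [x|].
  rewrite -(subrK p.[cayley x] (f x)) (le_trans (ler_normcD _ _))// lerD//.
  by apply: pM; rewrite normc_cayley.
rewrite -(subrK p.[0] c) (le_trans (ler_normcD _ _))// lerD//.
by apply: pM; rewrite normc0.
Qed.

Lemma normc_subM_le (a b a' b' : R[i]) :
  normc (a * b - a' * b') <= normc (a - a') * normc b + normc a' * normc (b - b').
Proof.
rewrite (_ : a * b - a' * b' = (a - a') * b + a' * (b - b')); last by ring.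
by rewrite (le_trans (ler_normcD _ _))// !normcM.
Qed.

Lemma disc_algebraM f g c d : disc_algebra f c -> disc_algebra g d ->
  disc_algebra (fun x => f x * g x) (c * d).
Proof.
move=> fc gd e e0.
have [M M0 [gM dM]] := disc_algebra_bounded gd.
(* The order of choice matters: the tolerance for [g] depends on a bound [N] for the polynomial
   already chosen for [f]. The divisor there is [1 + N] since [N] may be zero. *)
have [p [fp cp]] := fc (e / 2 / M) ltac:(by rewrite !divr_gt0).
have [N N0 pN] := horner_bounded p.
have N1 : 0 < 1 + N by rewrite ltr_pwDl.
have [q [gq dq]] := gd (e / 2 / (1 + N)) ltac:(by rewrite !divr_gt0).
have H (a b a' b' : R[i]) : normc (a - a') <= e / 2 / M -> normc b <= M ->
    normc a' <= N -> normc (b - b') <= e / 2 / (1 + N) ->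
    normc (a * b - a' * b') <= e.
  move=> h1 h2 h3 h4; rewrite (le_trans (normc_subM_le _ _ _ _))// [leRHS]splitr.
  apply: lerD.
    rewrite -[leRHS](divfK (lt0r_neq0 M0)).
    by apply: ler_pM; rewrite ?normc_ge0.
  rewrite -[leRHS](divfK (lt0r_neq0 N1)) mulrC.
  by apply: ler_pM; rewrite ?normc_ge0// (le_trans h3)// lerDr.
exists (p * q); split => [x|]; rewrite hornerM; apply: H => //.
- by apply: pN; rewrite normc_cayley.
- by apply: pN; rewrite normc0.
Qed.

Lemma disc_algebraX f c n : disc_algebra f c ->
  disc_algebra (fun x => f x ^+ n) (c ^+ n).
Proof.
move=> fc; elim: n => [|n IH].
  by under eq_fun do rewrite expr0; exact: disc_algebra_cst.
by under eq_fun do rewrite exprS; rewrite exprS; exact: disc_algebraM.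
Qed.

Lemma disc_algebra_sum n (f : nat -> R -> R[i]) (c : nat -> R[i]) :
  (forall k, disc_algebra (f k) (c k)) ->
  disc_algebra (fun x => \sum_(k < n) f k x) (\sum_(k < n) c k).
Proof.
move=> fc; elim: n => [|n IH].
  by under eq_fun do rewrite big_ord0; rewrite big_ord0; exact: disc_algebra_cst.
by under eq_fun do rewrite big_ord_recr/=; rewrite big_ord_recr/=; exact: disc_algebraD.
Qed.

Lemma normc_geometric_le (a : R[i]) (q : R) n : q < 1 -> normc a <= q ->
  normc ((1 - a)^-1 - \sum_(k < n) a ^+ k) <= q ^+ n / (1 - q).
Proof.
move=> q1 aq; have a1 : 1 - q <= normc (1 - a).
  by rewrite (le_trans _ (ler_sub_normc _ _))// normc1 lerB.
have q0 : 0 < 1 - q by rewrite subr_gt0.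
have a0 : 1 - a != 0 by rewrite -normc_gt0 (lt_le_trans q0).
have -> : (1 - a)^-1 - \sum_(k < n) a ^+ k = a ^+ n / (1 - a).
  have S : (1 - a) * \sum_(k < n) a ^+ k = 1 - a ^+ n.
    by rewrite -opprB mulNr -subrX1 opprB.
  by apply: (mulfI a0); rewrite mulrBr divff// S mulrCA divff// mulr1; ring.
rewrite normcM normcV normcX; apply: ler_pM.
- by rewrite exprn_ge0// normc_ge0.
- by rewrite invr_ge0 normc_ge0.
- by rewrite lerXn2r// nnegrE ?normc_ge0// (le_trans (normc_ge0 a)).
- by rewrite lef_pV2// posrE normc_gt0.
Qed.

Lemma cvg_geometric_small (q C e : R) : 0 <= q -> q < 1 -> 0 < e ->
  exists n, q ^+ n * C <= e.
Proof.
move=> q0 q1 e0.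
have h : (fun n => q ^+ n * C) @ \oo --> 0.
  rewrite -[0](mul0r C); apply: cvgM; last exact: cvg_cst.
    by apply: cvg_expr; rewrite ger0_norm.
have : \forall n \near \oo, q ^+ n * C <= e.
  move/cvgrPdist_le : h => /(_ _ e0); apply: filterS => n; rewrite sub0r normrN.
  exact/le_trans/ler_norm.
by case=> n _ /(_ n (leqnn n)) ?; exists n.
Qed.

(** Inversion goes through the Neumann series, so the ratio must stay below a constant [q < 1]
    uniformly on the line and also at the point i. [disc_algebra_shiftV] recentres its series to
    meet this requirement. *)
Lemma disc_algebra_geometric f c (q : R) : q < 1 -> disc_algebra f c ->
  (forall x, normc (f x) <= q) -> normc c <= q ->
  disc_algebra (fun x => (1 - f x)^-1) (1 - c)^-1.
Proof.
move=> q1 fc fq cq; apply: disc_algebra_lim => e e0.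
have q0 : 0 <= q by rewrite (le_trans (normc_ge0 c)).
have [n nq] := cvg_geometric_small (1 - q)^-1 q0 q1 e0.
exists (fun x => \sum_(k < n) f x ^+ k), (\sum_(k < n) c ^+ k); split.
- apply: (@disc_algebra_sum n (fun k x => f x ^+ k) (fun k => c ^+ k)) => k.
  exact: disc_algebraX.
- by move=> x; rewrite (le_trans (normc_geometric_le _ q1 (fq x))).
- by rewrite (le_trans (normc_geometric_le _ q1 cq)).
Qed.

Lemma poisson_mean_disc_algebra f c : cmeasurable f -> disc_algebra f c ->
  poisson_mean f = pi%:C%C * c.
Proof.
move=> mf fc; apply/eqP; rewrite -subr_eq0 -normc_eq0; apply/eqP.
apply/le_anti; rewrite normc_ge0 andbT; apply/ler_addgt0Pr => e e0; rewrite add0r.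
have p0 := @pi_gt0 R.
(* The integral of the error costs [2 * pi] times the tolerance (the 2 is that of
   [normc_cintegral_le]), the value at i costs [pi] times it. *)
have d0 : 0 < e / (3 * pi) by rewrite divr_gt0// mulr_gt0.
have [p [fp cp]] := fc _ d0.
have [M M0 [fM _]] := disc_algebra_bounded fc.
have [N N0 pN] := horner_bounded p.
rewrite -(subrKA (poisson_mean (fun x => p.[cayley x]))).
rewrite (le_trans (ler_normcD _ _))// (_ : e = 2 * (e / (3 * pi) * pi) + pi * (e / (3 * pi))); last first.
  have E (P : R) : P != 0 -> e = 2 * (e / (3 * P) * P) + P * (e / (3 * P)) by move=> ?; field.
  by apply: E; rewrite gt_eqF.
apply: lerD; last first.
  rewrite poisson_mean_horner -mulrBr normcM normc_real gtr0_norm//.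
  by rewrite ler_wpM2l ?(ltW p0)// normc_distC.
have if_ := cintegrable_poisson mf fM.
have ip : cintegrable mu (fun x => ((oneDsqr x)^-1)%:C%C * p.[cayley x]).
  apply: (@cintegrable_poisson _ N); first exact: cmeasurable_horner_cayley.
  by move=> x; apply: pN; rewrite normc_cayley.
rewrite /poisson_mean -cintegralB//.
have -> : e / (3 * pi) * pi = \int[mu]_x (e / (3 * pi) * (oneDsqr x)^-1).
  rewrite RintegralZl//; last exact: integrable_oneDsqrV.
  by rewrite [X in _ = _ * X]/Rintegral integral_oneDsqrV.
apply: normc_cintegral_le.
- under eq_fun do rewrite -(mulN1r (_ * p.[_])).
  by apply: cintegrableD => //; exact: cintegrableZ.
- exact: (integrableZl _ _ integrable_oneDsqrV).
- move=> x; rewrite -mulrBr normcM normc_real ger0_norm ?oneDsqrV_ge0// mulrC.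
  by rewrite ler_wpM2r// oneDsqrV_ge0.
Qed.

End disc_algebra.

(** * Geometric expansion of the Stieltjes kernel in the Cayley variable *)

Section cayley_expansion.
Context {R : realType}.
Implicit Types (x t e : R).

(* the pole of the Cayley variable for the kernel [(t - (x + ie))^-1] is
   [- alpha / beta] with [alpha = t - i (1 + e)], [beta = t - i (e - 1)] *)
Definition cayley_ratio e t : R[i] :=
  - ((t%:C - (0 +i* (e - 1))) / (t%:C - (0 +i* (1 + e))))%C.

(** With [W = cayley x] and [z = x + ie] one has [(1 + W) (t - z) = alpha + beta W]. Dividing by
    [alpha (t - z)] shows the kernel as the fixed point of an affine map, ready to be iterated. *)
Lemma kernel_cayleyE x t e : 0 < e ->
  (t%:C - (x +i* e))%C^-1 =
  (1 + cayley x) / (t%:C - (0 +i* (1 + e)))%C +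
    cayley_ratio e t * cayley x * (t%:C - (x +i* e))%C^-1.
Proof.
move=> e0; rewrite /cayley_ratio.
have z0 : (t%:C - (x +i* e))%C != 0 by rewrite subz_neq0//= gt_eqF.
have a0 : (t%:C - (0 +i* (1 + e)))%C != 0.
  by rewrite subz_neq0//= gt_eqF// addr_gt0.
have i0 : (1 -i* x)%C != 0 :> R[i].
  by rewrite eq_complex /= oner_eq0.
have E : (1 + cayley x) * (t%:C - (x +i* e))%C =
  (t%:C - (0 +i* (1 + e)))%C + (t%:C - (0 +i* (e - 1)))%C * cayley x.
  apply: (mulfI i0); rewrite [LHS]mulrA [X in X * _]mulrDr mulr1 cayleyE.
  rewrite [RHS]mulrDr [(1 -i* x)%C * (_ * _)]mulrCA cayleyE.
  by apply: complex_eqP => /=; ring.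
move: a0 z0 E; generalize (t%:C - (0 +i* (1 + e)))%C (t%:C - (0 +i* (e - 1)))%C.
generalize (t%:C - (x +i* e))%C (cayley x) => z W al be al0 z0 E.
transitivity (((1 + W) * z - be * W) / (al * z)); last by field; rewrite al0 z0.
by rewrite E addrK; field; rewrite al0 z0.
Qed.

(** The remainder is kept exact. As W has modulus 1, it is at most [|cayley_ratio e t|^n / e],
    uniformly in [x]. *)
Lemma kernel_cayley_expansion x t e n : 0 < e ->
  (t%:C - (x +i* e))%C^-1 =
  \sum_(k < n) (1 + cayley x) * cayley x ^+ k *
      (cayley_ratio e t ^+ k / (t%:C - (0 +i* (1 + e)))%C) +
    (cayley_ratio e t * cayley x) ^+ n * (t%:C - (x +i* e))%C^-1.
Proof.
move=> e0; elim: n => [|n IH]; first by rewrite big_ord0 add0r expr0 mul1r.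
rewrite {1}IH big_ord_recr/= -addrA; congr (_ + _).
rewrite {1}(kernel_cayleyE x t e0) [in RHS]exprSr exprMn.
by ring.
Qed.

(** Numerator and denominator have squared moduli [t^2 + (e - 1)^2] and [t^2 + (e + 1)^2]. *)
Lemma normc_cayley_ratio_lt1 e t : 0 < e -> normc (cayley_ratio e t) < 1.
Proof.
move=> e0; rewrite /cayley_ratio normc_opp normcM normcV.
rewrite ltr_pdivrMr; last by rewrite normc_gt0 subz_neq0//= gt_eqF// addr_gt0.
rewrite mul1r -(ltr_pXn2r (n := 2)) ?nnegrE ?normc_ge0//.
by rewrite !sqr_normcB_real/= ltrD2l; nra.
Qed.

Lemma cmeasurable_cayley_ratioX e n : 0 < e ->
  cmeasurable (fun t => cayley_ratio e t ^+ n).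
Proof.
move=> e0.
have h : cmeasurable (cayley_ratio e).
  rewrite (_ : cayley_ratio e = fun t => (-1) * ((t%:C - (0 +i* (e - 1)))%C * (t%:C - (0 +i* (1 + e)))%C^-1)).
    apply: cmeasurableM; first exact: cmeasurable_cst.
    apply: cmeasurableM; last by apply: cmeasurable_kernel; rewrite /= gt_eqF// addr_gt0.
    by split => /=; [exact: measurable_funB|exact: measurable_cst].
  by apply/funext => t; rewrite /cayley_ratio mulN1r.
elim: n => [|n IH].
  by under eq_fun do rewrite expr0; exact: cmeasurable_cst.
by under eq_fun do rewrite exprS; exact: cmeasurableM.
Qed.

End cayley_expansion.

Section stieltjes_disc_algebra.
Context {R : realType}.
Variable m : {measure set (measurableTypeR R) -> \bar R}.
Variable w : R -> R.
Hypothesis w0 : forall x, 0 <= w x.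
Hypothesis wi : m.-integrable setT (EFin \o w).
Implicit Types z : R[i].

Let wm : measurable_fun setT w.
Proof. by apply/measurable_EFinP; exact: (measurable_int m). Qed.

Lemma measurable_normc (f : R -> R[i]) : cmeasurable f ->
  measurable_fun setT (fun x => normc (f x)).
Proof.
move=> [fr fi]; under eq_fun do rewrite normc_sqrtE.
apply: (measurableT_comp (f := @Num.sqrt R)).
  by apply: continuous_measurable_fun; exact: sqrt_continuous.
by apply: measurable_funD; exact: measurable_funX.
Qed.

Let errE e n t : 0 < e ->
  `|w t * normc (cayley_ratio e t) ^+ n| <= w t.
Proof.
move=> e0; rewrite normrM (ger0_norm (w0 t)) ger0_norm ?exprn_ge0 ?normc_ge0//.
by rewrite ler_piMr// exprn_ile1 ?normc_ge0// ltW// normc_cayley_ratio_lt1.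
Qed.

Let errm e n : 0 < e ->
  measurable_fun setT (fun t => w t * normc (cayley_ratio e t) ^+ n).
Proof.
move=> e0; apply: measurable_funM => //.
under eq_fun do rewrite -normcX.
by apply: measurable_normc; exact: cmeasurable_cayley_ratioX.
Qed.

Let erri e n : 0 < e ->
  m.-integrable setT (EFin \o (fun t => w t * normc (cayley_ratio e t) ^+ n)).
Proof.
move=> e0; apply: (le_integrable measurableT _ _ wi).
  by apply/measurable_EFinP; exact: errm.
by move=> t _ /=; rewrite lee_fin (ger0_norm (w0 t)) errE.
Qed.

(** The ratio tends to modulus 1 as [|t|] grows, so the geometric decay is not uniform in [t];
    dominated convergence with [w] as dominating function takes its place. *)
Lemma cvg_Rintegral_cayley_ratio e : 0 < e ->
  (\int[m]_t (w t * normc (cayley_ratio e t) ^+ n)) @[n --> \oo] --> (0 : R).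
Proof.
move=> e0.
have [||||| _ _ h] := @dominated_convergence _ _ _ m setT measurableT
  (fun n t => (w t * normc (cayley_ratio e t) ^+ n)%:E) (fun=> 0%E) (EFin \o w).
- by move=> n; apply/measurable_EFinP; exact: errm.
- exact: measurable_cst.
- apply: aeW => t _; apply: cvg_EFin; first exact: nearW.
  rewrite -[X in _ --> X](mulr0 (w t)); apply: cvgM; first exact: cvg_cst.
  by apply: cvg_expr; rewrite ger0_norm ?normc_ge0// normc_cayley_ratio_lt1.
- exact: wi.
- by apply: aeW => t n _; rewrite lee_fin errE.
by move: h; rewrite integral0 => /fine_cvg.
Qed.

(** Integrating the kernel expansion against [w] leaves a polynomial in W and a remainder that is
    small uniformly in [x]. The second argument is the transform at [i + ie], the point where
    [x = i]. *)
Lemma disc_algebra_stieltjes e : 0 < e ->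
  disc_algebra (fun x => stieltjes m w (x +i* e)%C) (stieltjes m w (0 +i* (1 + e))%C).
Proof.
move=> e0 d d0.
have e1 : 0 < 1 + e by rewrite addr_gt0.
set al := fun t : R => (t%:C - (0 +i* (1 + e)))%C.
pose c k := cintegral m (fun t => (w t)%:C%C * (cayley_ratio e t ^+ k / al t)).
(* The factor 2 is that of [normc_cintegral_le], and [e^-1] bounds the kernel left in the
   remainder. *)
have [n nd] : exists n, 2 * (e^-1 * \int[m]_t (w t * normc (cayley_ratio e t) ^+ n.+1)) <= d.
  have /cvgrPdist_le/(_ (d * e / 2)) h := cvg_Rintegral_cayley_ratio e0.
  have [|n _ /(_ n.+1 (leqnSn n))] := h _; first by rewrite divr_gt0// mulr_gt0.
  rewrite sub0r normrN => H; exists n; apply: (le_trans (ler_wpM2l _ (ler_wpM2l _ (le_trans (ler_norm _) H)))) => //.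
    by rewrite invr_ge0 ltW.
  by rewrite le_eqVlt; apply/orP; left; apply/eqP; field; rewrite gt_eqF.
have ci k : cintegrable m (fun t => (w t)%:C%C * (cayley_ratio e t ^+ k / al t)).
  apply: (@cintegrable_normc_le _ _ _ (fun t => (1 + e)^-1 * w t)).
  - apply: cmeasurableM; first by split => //=; exact: measurable_cst.
    apply: cmeasurableM; first exact: cmeasurable_cayley_ratioX.
    by apply: cmeasurable_kernel; rewrite /= gt_eqF.
  - exact: (integrableZl _ _ wi).
  - move=> t; rewrite normcM normc_real ger0_norm// mulrC ler_wpM2r//.
    rewrite normcM normcX -[leRHS]mul1r; apply: ler_pM; rewrite ?exprn_ge0 ?normc_ge0//.
      by rewrite exprn_ile1 ?normc_ge0// ltW// normc_cayley_ratio_lt1.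
    exact: normc_kernel_le.
(* [1 + 'X] is the factor [1 + W] common to all terms; at 0 only [c 0] survives, which is the
   transform at [i (1 + e)]. *)
exists ((1 + 'X) * \poly_(k < n.+1) c k); split => [x|]; last first.
  rewrite hornerM horner_poly big_ord_recl big1 => [|k _]; last first.
    by rewrite expr0n mulr0.
  rewrite !hornerE ?expr0 ?mulr1 ?mul1r.
  rewrite [c _](_ : _ = stieltjes m w (0 +i* (1 + e))%C).
    by rewrite subrr normc0 ltW.
  by apply: eq_cintegral => t; rewrite expr0 mul1r.
have Pi : cintegrable m (fun t => \sum_(k < n.+1) (1 + cayley x) * cayley x ^+ k *
    ((w t)%:C%C * (cayley_ratio e t ^+ k / al t))).
  apply: (@cintegrable_sum _ _ _ (fun k t => (1 + cayley x) * cayley x ^+ k *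
    ((w t)%:C%C * (cayley_ratio e t ^+ k / al t)))) => k.
  exact: cintegrableZ.
have -> : ((1 + 'X) * \poly_(k < n.+1) c k).[cayley x] =
    cintegral m (fun t => \sum_(k < n.+1) (1 + cayley x) * cayley x ^+ k *
      ((w t)%:C%C * (cayley_ratio e t ^+ k / al t))).
  rewrite (@cintegral_sum _ _ _ (fun k t => (1 + cayley x) * cayley x ^+ k *
      ((w t)%:C%C * (cayley_ratio e t ^+ k / al t)))); last first.
    by move=> k; exact: cintegrableZ.
  rewrite hornerM horner_poly !hornerE mulr_sumr; apply: eq_bigr => k _.
  by rewrite cintegralZ// /c; ring.
have Fi : cintegrable m (fun t => (w t)%:C%C / (t%:C%C - (x +i* e)%C)).
  exact: cintegrable_stieltjes.
rewrite /stieltjes -cintegralB//.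
set D := fun t => _ - _.
have DE t : D t = (w t)%:C%C * ((cayley_ratio e t * cayley x) ^+ n.+1 * (t%:C - (x +i* e))%C^-1).
  rewrite /D {1}(kernel_cayley_expansion x t n.+1 e0) mulrDr addrAC.
  rewrite mulr_sumr -sumrB big1 ?add0r// => k _.
  by rewrite mulrCA subrr.
have Di : cintegrable m D.
  rewrite /D; under eq_fun do rewrite -(mulN1r (\sum_(k < _) _)).
  by apply: cintegrableD => //; exact: cintegrableZ.
apply: le_trans nd; rewrite -RintegralZl//; last exact: erri.
apply: normc_cintegral_le => //; first exact: (integrableZl _ _ (erri _ e0)).
move=> t; rewrite DE normcM normc_real ger0_norm// mulrCA ler_wpM2l//.
rewrite normcM mulrC normcX normcM normc_cayley mulr1 ler_wpM2r//.
  by rewrite exprn_ge0// normc_ge0.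
exact: normc_kernel_le.
Qed.

End stieltjes_disc_algebra.

(** * Blow-up sets of Stieltjes transforms are Lebesgue null *)

Section herglotz_bound.
Context {R : realType}.
Variable m : {measure set (measurableTypeR R) -> \bar R}.
Variable w : R -> R.
Hypothesis w0 : forall x, 0 <= w x.
Hypothesis wi : m.-integrable setT (EFin \o w).
Notation mu := (@lebesgue_measure R).
Notation F := (stieltjes m w).
Implicit Types (x e t : R).

Lemma lipschitz_continuous_real (f : R -> R) (C : R) :
  (forall x y, `|f x - f y| <= C * `|x - y|) -> continuous f.
Proof.
move=> fC x; apply/cvgrPdist_le => e e0; near=> y.
have C0 : 0 < `|C| + 1 by rewrite ltr_wpDl.
apply: (le_trans (fC _ _)).
apply: (@le_trans _ _ ((`|C| + 1) * `|x - y|)).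
  by rewrite ler_wpM2r// (le_trans (ler_norm _))// lerDl.
rewrite -ler_pdivlMl// mulrC.
near: y; apply: cvgr_dist_le; first exact: cvg_id.
by rewrite divr_gt0.
Unshelve. all: by end_near. Qed.

Lemma continuous_div_sumsqr (P Q S : R -> R) :
  (forall x, P x ^+ 2 + Q x ^+ 2 != 0) -> continuous P -> continuous Q ->
  continuous S -> continuous (fun x => S x / (P x ^+ 2 + Q x ^+ 2)).
Proof.
move=> PQ0 cP cQ cS x; apply: cvgM; first exact: cS.
apply: cvgV; first exact: PQ0.
apply: (@cvgD _ _ _ _ _ (fun x => P x ^+ 2) (fun x => Q x ^+ 2)).
  by apply: (@continuous_comp _ _ _ P (fun y => y ^+ 2)); [exact: cP|exact: exprn_continuous].
by apply: (@continuous_comp _ _ _ Q (fun y => y ^+ 2)); [exact: cQ|exact: exprn_continuous].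
Qed.

Lemma cmeasurableV_continuous (f : R -> R[i]) : (forall x, f x != 0) ->
  continuous (fun x => Re (f x)) -> continuous (fun x => Im (f x)) ->
  cmeasurable (fun x => (f x)^-1).
Proof.
move=> f0 cR cI.
have {}f0 x : Re (f x) ^+ 2 + Im (f x) ^+ 2 != 0.
  by rewrite -sqr_normcE expf_neq0// normc_eq0.
split; apply: continuous_measurable_fun.
- under eq_fun do rewrite ReVc sqr_normcE.
  exact: (continuous_div_sumsqr f0 cR cI cR).
- under eq_fun do rewrite ImVc sqr_normcE.
  apply: (continuous_div_sumsqr f0 cR cI) => x.
  by apply: cvgN; exact: cI.
Qed.

Lemma stieltjes_lipschitz_line x y e : 0 < e ->
  normc (F (x +i* e)%C - F (y +i* e)%C) <= 2 * mass m w / e ^+ 2 * `|x - y|.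
Proof.
move=> e0; apply: (le_trans (normc_stieltjesB_le w0 wi (z := (x +i* e)%C) (z' := (y +i* e)%C) e0 e0)).
have -> : (x +i* e)%C - (y +i* e)%C = (x - y)%:C%C.
  by apply: complex_eqP => //=; rewrite subrr.
rewrite normc_real expr2.
by rewrite le_eqVlt; apply/orP; left; apply/eqP; ring.
Qed.

Lemma continuous_Re_stieltjes e : 0 < e -> continuous (fun x => Re (F (x +i* e)%C)).
Proof.
move=> e0; apply: (@lipschitz_continuous_real _ (2 * mass m w / e ^+ 2)) => x y.
apply: le_trans (stieltjes_lipschitz_line _ _ e0).
by apply: le_trans (ler_Re_normc _); rewrite ReDc ReNc.
Qed.

Lemma continuous_Im_stieltjes e : 0 < e -> continuous (fun x => Im (F (x +i* e)%C)).
Proof.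
move=> e0; apply: (@lipschitz_continuous_real _ (2 * mass m w / e ^+ 2)) => x y.
apply: le_trans (stieltjes_lipschitz_line _ _ e0).
by apply: le_trans (ler_Im_normc _); rewrite ImDc ImNc.
Qed.

Lemma Re_shift z t : Re (F z + (0 +i* t)%C) = Re (F z).
Proof. by rewrite ReDc addr0. Qed.

Lemma Im_shift z t : Im (F z + (0 +i* t)%C) = Im (F z) + t.
Proof. by rewrite ImDc. Qed.

Lemma Im_shift_gt0 x e t : 0 < e -> 0 < t -> 0 < Im (F (x +i* e)%C + (0 +i* t)%C).
Proof. by move=> e0 t0; rewrite Im_shift ltr_wpDl// Im_stieltjes_ge0. Qed.

Lemma shift_neq0 x e t : 0 < e -> 0 < t -> F (x +i* e)%C + (0 +i* t)%C != 0.
Proof. by move=> e0 t0; rewrite Im_neq0// gt_eqF// Im_shift_gt0. Qed.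

Lemma normc_shift_ge x e t : 0 < e -> 0 < t ->
  t <= normc (F (x +i* e)%C + (0 +i* t)%C).
Proof.
move=> e0 t0; apply: le_trans (ler_Im_normc _); apply: le_trans (ler_norm _).
by rewrite Im_shift lerDr Im_stieltjes_ge0.
Qed.

Lemma cmeasurable_shiftV e t : 0 < e -> 0 < t ->
  cmeasurable (fun x => (F (x +i* e)%C + (0 +i* t)%C)^-1).
Proof.
move=> e0 t0.
apply: cmeasurableV_continuous.
- by move=> x; exact: shift_neq0.
- under eq_fun do rewrite Re_shift.
  exact: continuous_Re_stieltjes.
- under eq_fun do rewrite Im_shift.
  by move=> x; apply: cvgD; [exact: continuous_Im_stieltjes|exact: cvg_cst].
Qed.

(* On [|z| <= M, 0 <= Im z] the geometric series of [(z + it)^-1] about the point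
   [iL] converges uniformly once [L >= M^2 / t]: its ratio is at most
   [sqrt (M^2 + L^2) / (t + L) = sqrt (L / (t + L))]. *)
Lemma disc_algebra_shiftV e t : 0 < e -> 0 < t ->
  disc_algebra (fun x => (F (x +i* e)%C + (0 +i* t)%C)^-1)
    (F (0 +i* (1 + e))%C + (0 +i* t)%C)^-1.
Proof.
move=> e0 t0; have e1 : 0 < 1 + e by rewrite addr_gt0.
have gF := disc_algebra_stieltjes w0 wi e0.
have [M M0 [FM F0M]] := disc_algebra_bounded gF.
pose L := M ^+ 2 / t.
have L0 : 0 < L by rewrite divr_gt0// exprn_gt0.
have tL : 0 < t + L by rewrite addr_gt0.
have a0 : (0 +i* (t + L))%C != 0 :> R[i].
  by rewrite Im_neq0//= gt_eqF.
pose a : R[i] := (0 +i* (t + L))%C.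
pose h (z : R[i]) := a^-1 * ((0 +i* L)%C + (-1) * z).
have hE z : (z + (0 +i* t)%C)^-1 = a^-1 * (1 - h z)^-1.
  rewrite -invfM; congr (_^-1); rewrite mulrBr mulr1 /h mulrA divff// mul1r.
  by rewrite mulN1r opprD opprK addrA [RHS]addrC; congr (_ + _); apply: complex_eqP => /=; ring.
pose q := Num.sqrt (L / (t + L)).
have q1 : q < 1.
  rewrite -[ltRHS]sqrtr1 ltr_sqrt// ltr_pdivrMr// mul1r ltrDr//.
have hq z : 0 <= Im z -> normc z <= M -> normc (h z) <= q.
  move=> z0 zM; rewrite /h /q normcM normcV -(ler_pXn2r (n := 2)) ?nnegrE ?sqrtr_ge0//; last first.
    by rewrite mulr_ge0 ?invr_ge0 ?normc_ge0.
  rewrite sqr_sqrtr; last by rewrite divr_ge0// ltW.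
  have RE : Re ((0 +i* L)%C + (-1) * z) = - Re z.
    by rewrite mulN1r ReDc ReNc add0r.
  have IE : Im ((0 +i* L)%C + (-1) * z) = L - Im z.
    by rewrite mulN1r ImDc ImNc.
  have aE : normc a ^+ 2 = (t + L) ^+ 2 by rewrite sqr_normcE /a /= expr0n add0r.
  have : Re z ^+ 2 + Im z ^+ 2 <= M ^+ 2.
    by rewrite -sqr_normcE lerXn2r// nnegrE ?normc_ge0// ltW.
  rewrite exprMn exprVn aE sqr_normcE RE IE.
  move=> H; rewrite mulrC ler_pdivrMr ?exprn_gt0//.
  rewrite (_ : L / (t + L) * (t + L) ^+ 2 = L * (t + L)); last by field; rewrite gt_eqF.
  have -> : L * (t + L) = M ^+ 2 + L ^+ 2 by rewrite /L; field; rewrite gt_eqF.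
  by nra.
under eq_fun do rewrite hE; rewrite hE.
apply: disc_algebraM; first exact: disc_algebra_cst.
apply: (disc_algebra_geometric q1).
- apply: disc_algebraM; first exact: disc_algebra_cst.
  apply: disc_algebraD; first exact: disc_algebra_cst.
  by apply: disc_algebraM; first exact: disc_algebra_cst.
- by move=> x; apply: hq => //; exact: Im_stieltjes_ge0.
- by apply: hq => //; exact: Im_stieltjes_ge0.
Qed.

Definition herglotz_test e t x : R :=
  Re (F (x +i* e)%C / (F (x +i* e)%C + (0 +i* t)%C)).

(** This form reduces membership in the disc algebra to that of the inverse, and shows that the
    distance to 1 is [t / |F + it|]. *)
Lemma herglotz_testE e t x : 0 < e -> 0 < t ->
  F (x +i* e)%C / (F (x +i* e)%C + (0 +i* t)%C) =
  1 + (0 -i* t)%C * (F (x +i* e)%C + (0 +i* t)%C)^-1.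
Proof.
move=> e0 t0; have := shift_neq0 x e0 t0 => h.
apply: (mulIf h); rewrite divfK// mulrDl divfK// mul1r -addrA.
by apply: complex_eqP; rewrite ?ReDc ?ImDc/=; ring.
Qed.

Lemma herglotz_test_ge0 e t x : 0 < e -> 0 < t -> 0 <= herglotz_test e t x.
Proof.
move=> e0 t0; rewrite /herglotz_test ReMc ReVc ImVc Re_shift Im_shift.
rewrite mulNr mulrN opprK !mulrA -mulrDl divr_ge0 ?sqr_ge0//.
by rewrite -expr2 addr_ge0 ?sqr_ge0// mulr_ge0 ?addr_ge0 ?Im_stieltjes_ge0 ?ltW.
Qed.

Lemma normc_herglotz_le1 e t x : 0 < e -> 0 < t ->
  normc (F (x +i* e)%C / (F (x +i* e)%C + (0 +i* t)%C)) <= 1.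
Proof.
move=> e0 t0; rewrite normcM normcV ler_pdivrMr ?normc_gt0 ?shift_neq0// mul1r.
rewrite -(ler_pXn2r (n := 2)) ?nnegrE ?normc_ge0// !sqr_normcE Re_shift Im_shift.
by rewrite lerD2l lerXn2r// ?nnegrE ?addr_ge0 ?Im_stieltjes_ge0 ?ltW// ltrDl.
Qed.

Lemma normr_herglotz_test_le1 e t x : 0 < e -> 0 < t -> `|herglotz_test e t x| <= 1.
Proof.
by move=> e0 t0; apply: (le_trans (ler_Re_normc _)); exact: normc_herglotz_le1.
Qed.

Lemma herglotz_test_near1 e t x : 0 < e -> 0 < t -> t < normc (F (x +i* e)%C) ->
  `|1 - herglotz_test e t x| <= t / (normc (F (x +i* e)%C) - t).
Proof.
move=> e0 t0 tF; rewrite /herglotz_test herglotz_testE// ReDc opprD addrA subrr add0r normrN.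
apply: (le_trans (ler_Re_normc _)); rewrite normcM normcV.
have -> : normc (0 -i* t)%C = t.
  by rewrite /normc expr0n add0r sqrrN sqrtr_sqr gtr0_norm.
rewrite ler_pM2l// lef_pV2 ?posrE ?subr_gt0// ?normc_gt0 ?shift_neq0//.
rewrite -[X in _ - X <= _](_ : normc (0 -i* t)%C = t); last first.
  by rewrite /normc expr0n add0r sqrrN sqrtr_sqr gtr0_norm.
apply: le_trans (ler_sub_normc _ _) _; rewrite le_eqVlt; apply/orP; left; apply/eqP.
by congr normc; apply: complex_eqP; rewrite ?ReDc ?ImDc /=; ring.
Qed.

Lemma cmeasurable_herglotz e t : 0 < e -> 0 < t ->
  cmeasurable (fun x => F (x +i* e)%C / (F (x +i* e)%C + (0 +i* t)%C)).
Proof.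
move=> e0 t0; apply: cmeasurableM; last exact: cmeasurable_shiftV.
by split; apply: continuous_measurable_fun;
  [exact: continuous_Re_stieltjes|exact: continuous_Im_stieltjes].
Qed.

(** The mean is [pi] times the value at i, for which the transform is taken at height [1 + e >= 1].
    There [|F| <= 2 * mass] and [|F + it| >= t], so the bound does not involve [e]. *)
Lemma integral_herglotz_test e t : 0 < e -> 0 < t ->
  (\int[mu]_x ((oneDsqr x)^-1 * herglotz_test e t x)%:E <= (pi * (2 * mass m w / t))%:E)%E.
Proof.
move=> e0 t0; have mf := cmeasurable_herglotz e0 t0.
have [ir _] := cintegrable_poisson mf (fun x => normc_herglotz_le1 x e0 t0).
have e1 : 0 < 1 + e by rewrite addr_gt0.
set F0 := F (0 +i* (1 + e))%C.
have gf : disc_algebra (fun x => F (x +i* e)%C / (F (x +i* e)%C + (0 +i* t)%C))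
    (F0 / (F0 + (0 +i* t)%C)).
  under eq_fun do rewrite herglotz_testE//; rewrite /F0 herglotz_testE//.
  apply: disc_algebraD; first exact: disc_algebra_cst.
  by apply: disc_algebraM; [exact: disc_algebra_cst|exact: disc_algebra_shiftV].
have := poisson_mean_disc_algebra mf gf.
move=> /(congr1 (@complex.Re R)); rewrite ReZ => E.
have ir' : mu.-integrable setT (EFin \o (fun x => (oneDsqr x)^-1 * herglotz_test e t x)).
  by apply: eq_integrable ir => // x _; apply: (congr1 EFin); exact: ReZ.
rewrite -[leLHS](@fineK R); last exact: integrable_fin_num ir'.
rewrite lee_fin -/(Rintegral _ _ _).
rewrite (_ : Rintegral _ _ _ = pi * Re (F0 / (F0 + (0 +i* t)%C))); last first.
  by rewrite -E; symmetry; apply: eq_Rintegral => x _; exact: ReZ.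
rewrite ler_pM2l ?pi_gt0//.
apply: (le_trans (ler_norm _)); apply: (le_trans (ler_Re_normc _)).
rewrite normcM normcV; apply: ler_pM; rewrite ?invr_ge0 ?normc_ge0//.
- apply: (le_trans (normc_stieltjes_le w0 wi (z := (0 +i* (1 + e))%C) e1)).
  by rewrite ler_pdivrMr//= ler_peMr ?lerDl ?(ltW e0)// mulr_ge0// mass_ge0.
- rewrite lef_pV2 ?posrE ?normc_gt0 ?shift_neq0//.
  exact: normc_shift_ge.
Qed.

(* By [integral_herglotz_test] the Poisson mean of [herglotz_test] is O(1/t),
   while [herglotz_test] tends to 1 wherever the transform blows up. *)
Lemma stieltjes_blowup_null (E : set R) : measurable (E : set (measurableTypeR R)) ->
  (forall x, E x -> forall C : R, exists N, forall n, (N <= n)%N ->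
     C <= normc (F (x +i* n.+1%:R^-1)%C)) ->
  mu E = 0%E.
Proof.
move=> mE HE.
have e0 n : 0 < n.+1%:R^-1 :> R by rewrite invr_gt0.
have mo : measurable_fun setT (fun x : R => (oneDsqr x)^-1).
  by apply: continuous_measurable_fun; exact: continuous_oneDsqrV.
have mf n t : 0 < t ->
    measurable_fun setT (fun x => ((oneDsqr x)^-1 * herglotz_test n.+1%:R^-1 t x)%:E).
  move=> t0; apply/measurable_EFinP; apply: measurable_funM => //.
  by have [] := cmeasurable_herglotz (e0 n) t0.
have bound t : 0 < t ->
    (\int[mu]_(x in E) ((oneDsqr x)^-1)%:E <= (pi * (2 * mass m w / t))%:E)%E.
  move=> t0.
  have [||||| _ _ h] := @dominated_convergence _ _ _ mu E mE
    (fun n x => ((oneDsqr x)^-1 * herglotz_test n.+1%:R^-1 t x)%:E)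
    (fun x => ((oneDsqr x)^-1)%:E) (fun x => ((oneDsqr x)^-1)%:E).
  - by move=> n; apply: measurable_funTS; exact: mf.
  - by apply: measurable_funTS; apply/measurable_EFinP.
  - apply: aeW => x Ex; apply: cvg_EFin; first exact: nearW.
    rewrite -[X in _ --> X]mulr1; apply: cvgM; first exact: cvg_cst.
    apply/cvgrPdist_le => d d0.
    (* Makes [|F| - t] at least [1 + t / d], so that the distance [t / (|F| - t)] to 1 is at most
       [d]. *)
    have [N HN] := HE x Ex (t + 1 + t / d).
    exists N => // n Nn; apply: (le_trans (herglotz_test_near1 _ _ _)) => //.
      apply: lt_le_trans (HN _ Nn); rewrite -addrA ltrDl addr_gt0// divr_gt0//.
    have H := HN _ Nn.
    have td : 0 < t / d by rewrite divr_gt0.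
    rewrite ler_pdivrMr; last by lra.
    rewrite -ler_pdivrMl// mulrC; lra.
  - exact: integrableS integrable_oneDsqrV.
  - apply: aeW => x n _; rewrite lee_fin normrM ger0_norm ?oneDsqrV_ge0//.
    by rewrite ler_piMr ?oneDsqrV_ge0// normr_herglotz_test_le1.
  move/cvg_lim : (h) => <- //; apply: lime_le; first by apply/cvg_ex; eexists; exact: h.
  apply: nearW => n; apply: le_trans (integral_herglotz_test (e0 n) t0).
  apply: ge0_subset_integral => //; first exact: mf.
  by move=> x _; rewrite lee_fin mulr_ge0 ?oneDsqrV_ge0 ?herglotz_test_ge0.
have I0 : (\int[mu]_(x in E) ((oneDsqr x)^-1)%:E = 0)%E.
  apply/le_anti/andP; split; last first.
    by apply: integral_ge0 => x _; rewrite lee_fin oneDsqrV_ge0.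
  apply/lee_addgt0Pr => d d0; rewrite add0e.
  (* [bound] is used at [t] equal to this constant over [d]; the added 1 keeps it positive when the
     mass is zero. *)
  have C0 : 0 < pi * (2 * mass m w) + 1.
    by rewrite ltr_wpDl// !mulr_ge0 ?pi_ge0 ?mass_ge0.
  apply: (le_trans (bound _ (divr_gt0 C0 d0))); rewrite lee_fin invf_div mulrA mulrA.
  rewrite ler_pdivrMr// mulrC ler_pM2l// lerDl//.
(* The integrand is positive everywhere, so a zero integral forces [E] itself to be null. *)
have /(ae_eq_integral_abs mu mE) : measurable_fun E (fun x : R => ((oneDsqr x)^-1)%:E).
  by apply: measurable_funTS; apply/measurable_EFinP.
case=> H _.
have {}H := H _.
have [|A [mA A0 EA]] := H.
  under eq_integral do rewrite /= ger0_norm ?oneDsqrV_ge0//.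
  exact: I0.
apply/eqP; rewrite -measure_le0 -A0 le_measure ?inE//.
by move=> x Ex; apply: EA => /= /(_ Ex) /eqP; rewrite eqe invr_eq0 gt_eqF//.
Qed.

End herglotz_bound.

(** * Dyadic densities *)

Section dyadic.
Context {R : realType}.
Variable nu : {measure set (measurableTypeR R) -> \bar R}.
Notation mu := (@lebesgue_measure R).
Implicit Types (x y : R) (n : nat) (j : int).

Definition dyadic_index n x : int := Num.floor (x * 2 ^+ n).

(** A fibre of the floor: each level partitions the line by construction, and nesting becomes a
    statement about integers. *)
Definition dyadic_cell n j : set R := [set x | dyadic_index n x = j].

Lemma dyadic_cellE n j :
  dyadic_cell n j = `[j%:~R / 2 ^+ n, (j + 1)%:~R / 2 ^+ n[%classic.
Proof.
apply/seteqP; split => x /=; rewrite in_itv/= ler_pdivrMr ?exprn_gt0//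
  ltr_pdivlMr ?exprn_gt0//.
  by move=> <-; exact: floor_itv.
by move=> h; apply: floor_def.
Qed.

Lemma measurable_dyadic_cell n j :
  measurable (dyadic_cell n j : set (measurableTypeR R)).
Proof. by rewrite dyadic_cellE; exact: measurable_itv. Qed.

Lemma lebesgue_dyadic_cell n j : mu (dyadic_cell n j) = (2 ^- n)%:E.
Proof.
rewrite dyadic_cellE lebesgue_measure_itv/= lte_fin ltr_pM2r ?invr_gt0 ?exprn_gt0//.
rewrite ltr_int ltrDl ltr01 -EFinB -mulrBl rmorphD/= addrAC subrr add0r mul1r.
by [].
Qed.

Lemma dyadic_cell_dist n x y : dyadic_cell n (dyadic_index n x) y ->
  `|x - y| <= 2 ^- n.
Proof.
have : dyadic_cell n (dyadic_index n x) x by [].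
rewrite dyadic_cellE /= !in_itv/= rmorphD/= mulrDl mul1r => /andP[a b] /andP[c d].
by rewrite ler_norml; lra.
Qed.

(** The floor of [x 2^n], scaled by [2^(n' - n)], is an integer at most [x 2^n'], hence at most the
    common floor at level [n']; scaling back bounds it by [y 2^n]. *)
Lemma dyadic_index_le n n' x y : (n <= n')%N ->
  dyadic_index n' x = dyadic_index n' y -> dyadic_index n x <= dyadic_index n y.
Proof.
move=> nn' E; rewrite /dyadic_index floor_ge_int.
rewrite -(ler_pM2r (exprn_gt0 (n' - n) (ltr0n _ 2))) -mulrA -exprD subnKC//.
have -> : (2%:R : R) ^+ (n' - n) = ((2 : int) ^+ (n' - n))%:~R by rewrite rmorphXn.
rewrite -rmorphM -floor_ge_int -/(dyadic_index n' y) -E floor_ge_int rmorphM rmorphXn/=.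
rewrite (_ : x * 2 ^+ n' = (x * 2 ^+ n) * 2 ^+ (n' - n)); last first.
  by rewrite -mulrA -exprD subnKC.
by rewrite ler_pM2r ?exprn_gt0// floor_le.
Qed.

Lemma dyadic_index_nested n n' x y : (n <= n')%N ->
  dyadic_index n' x = dyadic_index n' y -> dyadic_index n x = dyadic_index n y.
Proof.
move=> nn' E; apply/le_anti; rewrite (dyadic_index_le nn' E).
by rewrite (dyadic_index_le nn' (esym E)).
Qed.

(* The maximal cells among the selected ones are pairwise disjoint. *)
Lemma dyadic_covering (P : nat -> int -> Prop) (k : R) : 0 <= k ->
  (forall n j, P n j -> (nu (dyadic_cell n j) <= (k / 2 ^+ n)%:E)%E) ->
  exists2 W : set R, measurable (W : set (measurableTypeR R)) &
    [/\ W = [set x | exists n, P n (dyadic_index n x)] &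
        (nu W <= k%:E * mu W)%E].
Proof.
move=> k0 Pk.
(* All points of a cell share its coarser cells, so the second clause says that no dyadic ancestor
   is selected. *)
pose top n j := P n j /\
  (forall x, dyadic_cell n j x -> forall n', (n' < n)%N -> ~ P n' (dyadic_index n' x)).
(* Decoding [i] into a pair turns the maximal cells into a sequence; indices coding no such cell
   give the empty set, which keeps the family disjoint. *)
pose B (i : nat) : set R := if pickle_inv i is Some (n, j) then
  [set x | top n j /\ dyadic_cell n j x] else set0.
have BE i : B i = set0 \/ exists n j, [/\ pickle_inv i = Some (n, j), top n j &
    B i = dyadic_cell n j].
  rewrite /B; case: (pickle_inv i) => [[n j]|]; last by left.
  have [h|h] := pselect (top n j).
    by right; exists n, j; split => //; apply/seteqP; split => x //= [].
  by left; apply/seteqP; split => x //= [].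
have mB i : measurable (B i : set (measurableTypeR R)).
  by have [->|[n [j [_ _ ->]]]] := BE i => //; exact: measurable_dyadic_cell.
have tB : trivIset setT B.
  move=> i i' _ _ [x []].
  have [->//|[n [j [ij [Pn Tn] ->]]]] := BE i.
  have [->//|[n' [j' [ij' [Pn' Tn'] ->]]]] := BE i'.
  move=> xj xj'.
  have nn' : n = n'.
    case: (ltngtP n n') => // lt; exfalso.
      by apply: (Tn' _ xj' _ lt); rewrite xj.
    by apply: (Tn _ xj _ lt); rewrite xj'.
  have jj' : j = j' by rewrite -xj -xj' nn'.
  have := @pickle_invK (nat * int)%type i; have := @pickle_invK (nat * int)%type i'.
  by rewrite ij ij' nn' jj' /= => <- <-.
have nuB i : (nu (B i) <= k%:E * mu (B i))%E.
  have [->|[n [j [_ [Pn _] ->]]]] := BE i; first by rewrite !measure0 mule0.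
  by rewrite lebesgue_dyadic_cell -EFinM; exact: Pk.
exists (\bigcup_i B i); first exact: bigcupT_measurable.
split.
  apply/seteqP; split => [x [i _]|x [n0 Pn0]].
    have [->//|[n [j [_ [Pn _] ->]]]] := BE i.
    by move=> xj; exists n; rewrite xj.
  have ex : exists n, `[< P n (dyadic_index n x) >] by exists n0; apply/asboolP.
  (* Levels start at 0, so a coarsest selected cell through [x] exists, and it is maximal. *)
  have [n /asboolP Pn nmin] := ex_minnP ex.
  exists (pickle (n, dyadic_index n x)) => //.
  rewrite /B pickleK_inv; split => //; split => // y yx n' n'n.
  move=> Pn'; have := nmin n'; rewrite leqNgt n'n => /(_ _)/negP; apply => //.
  apply/asboolP; rewrite (_ : dyadic_index n' x = dyadic_index n' y)//.
  by apply: (dyadic_index_nested (ltnW n'n)); rewrite yx.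
rewrite !measure_semi_bigcup//; try exact: bigcupT_measurable.
rewrite -nneseriesZl//; apply: lee_nneseries => // i _.
Qed.

(** For fixed [k], the points with density bound [k] are covered by cells lying in an open set of
    small Lebesgue measure, and [dyadic_covering] bounds the [nu]-mass of these cells by [k] times
    that measure. *)
Lemma dyadic_density_null (A : set R) : measurable (A : set (measurableTypeR R)) ->
  mu A = 0%E ->
  (forall x, A x -> exists k : nat, forall n0, exists2 n, (n0 <= n)%N &
     (nu (dyadic_cell n (dyadic_index n x)) <= (k%:R / 2 ^+ n)%:E)%E) ->
  nu A = 0%E.
Proof.
move=> mA A0 HA.
pose Ak (k : nat) := [set x | A x /\ forall n0, exists2 n, (n0 <= n)%N &
     (nu (dyadic_cell n (dyadic_index n x)) <= (k%:R / 2 ^+ n)%:E)%E].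
have cover k (e : R) : 0 < e -> exists W : set R,
    [/\ measurable (W : set (measurableTypeR R)), Ak k `<=` W & (nu W <= e%:E)%E].
  move=> e0; have k1 : 0 < k%:R + 1 :> R by rewrite ltr_wpDl.
  (* The divisor gives [k * (e / (k + 1)) <= e] and stays positive for [k = 0]. *)
  have d0 : 0 < e / (k%:R + 1) by rewrite divr_gt0.
  have Ay : (mu A < +oo)%E by rewrite A0 ltry.
  have [U [oU AU UA]] := lebesgue_regularity_outer mA Ay d0.
  pose P n j := dyadic_cell n j `<=` U /\
    (nu (dyadic_cell n j) <= (k%:R / 2 ^+ n)%:E)%E.
  have [|n j []//|W mW [WE WU]] := @dyadic_covering P k%:R.
    by [].
  exists W; split => //.
    move=> x [Ax Hx]; rewrite WE /=.
    have /nbhs_ballP[r /= r0 xr] : nbhs x U by apply: open_nbhs_nbhs; split => //; exact: AU.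
    have [n0 n0r] := @cvg_geometric_small R 2^-1 1 (r / 2) ltac:(by []) ltac:(lra) ltac:(by rewrite divr_gt0).
    have [n n0n nk] := Hx n0.
    exists n; split => // y yx; apply: xr; rewrite /ball/=.
    apply: (le_lt_trans (dyadic_cell_dist yx)).
    apply: (@le_lt_trans _ _ (2 ^- n0)).
      by rewrite lef_pV2 ?posrE ?exprn_gt0// ler_eXn2l// ltr1n.
    by move: n0r; rewrite mulr1 exprVn; lra.
  apply: (le_trans WU); apply: (@le_trans _ _ (k%:R%:E * (e / (k%:R + 1))%:E)%E).
    apply: lee_wpmul2l; first by rewrite lee_fin.
    apply: (@le_trans _ _ (mu U)).
      apply: le_measure; rewrite ?inE//; first exact: open_measurable.
      by rewrite WE => x [n [+ _]]; apply.
    have h : (mu ((U `\` A) `|` A) <= mu (U `\` A) + mu A)%E.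
      by apply: measureU2 => //; apply: measurableD => //; exact: open_measurable.
    by move: h; rewrite setDKU// A0 adde0 => /le_trans; apply; exact: ltW.
  rewrite -EFinM lee_fin mulrA ler_pdivrMr// mulrC.
  by rewrite ler_wpM2l ?ltW// ltrDl.
(* Measurability of [Ak k] is avoided: it is enclosed in a measurable null set, the intersection of
   covers of mass at most [1 / (n + 1)]. *)
have neg k : nu.-negligible (Ak k).
  have e0 n : 0 < n.+1%:R^-1 :> R by rewrite invr_gt0.
  pose W n := projT1 (cid (cover k _ (e0 n))).
  have WP n := projT2 (cid (cover k _ (e0 n))).
  exists (\bigcap_n W n); split.
  - by apply: bigcapT_measurable => n; have [] := WP n.
  - apply/eqP; rewrite -measure_le0; apply/lee_addgt0Pr => e e1; rewrite add0e.
    have [n ne] : exists n, n.+1%:R^-1 <= e.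
      exists (Num.trunc e^-1); rewrite -[leRHS]invrK lef_pV2 ?posrE ?invr_gt0//.
      by apply/ltW; rewrite truncnS_gt.
    have [mW _ We] := WP n.
    apply: (@le_trans _ _ (nu (W n))); last by rewrite (le_trans We)// lee_fin.
    apply: le_measure; rewrite ?inE//; last exact: bigcap_inf.
    by apply: bigcapT_measurable => i; have [] := WP i.
  - by move=> x kx n _; have [_ + _] := WP n; apply.
have [W [mW W0 AW]] := negligible_bigcup neg.
apply/eqP; rewrite -measure_le0 -W0; apply: le_measure; rewrite ?inE//.
move=> x Ax; have [k hk] := HA x Ax.
by apply: AW; exists k.
Qed.

End dyadic.

(** * Boundary values where the square integral is finite *)

Section square_integral.
Context {R : realType}.
Variable m : {measure set (measurableTypeR R) -> \bar R}.
Variable w : R -> R.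
Hypothesis w0 : forall x, 0 <= w x.
Hypothesis wi : m.-integrable setT (EFin \o w).
Implicit Types (l x e : R).
Notation F := (stieltjes m w).

Let wm : measurable_fun setT w.
Proof. by apply/measurable_EFinP; exact: (measurable_int m). Qed.

(** The integrand of [Im F(l + ie) / e] for [e = 1 / (n + 1)], increasing in [n]. *)
Let kern l n x : R := w x * ((x - l) ^+ 2 + n.+1%:R^-1 ^+ 2)^-1.

Let wsq l x : \bar R := ((w x)%:E * (`|x - l| ^+ 2)%:E^-1)%E.

Let sqi l : \bar R := (\int[m]_x wsq l x)%E.

Let n0 n : n.+1%:R^-1 != 0 :> R.
Proof. by rewrite invr_neq0// pnatr_eq0. Qed.

Let npos n : 0 < n.+1%:R^-1 :> R.
Proof. by rewrite invr_gt0. Qed.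

Let kern_ge0 l n x : 0 <= kern l n x.
Proof. by rewrite mulr_ge0// invr_ge0 ltW// kernel_denom_gt0. Qed.

Let kern_meas l n : measurable_fun setT (kern l n).
Proof.
apply: measurable_funM => //; apply: continuous_measurable_fun => x.
by apply: cvgV; [rewrite gt_eqF// kernel_denom_gt0|exact: continuous_kernel_denom].
Qed.

Let cvg_inv_denom (t : R) : t != 0 ->
  (t ^+ 2 + n.+1%:R^-1 ^+ 2)^-1 @[n --> \oo] --> (t ^+ 2)^-1.
Proof.
move=> t0; apply: cvgV; first by rewrite expf_neq0.
rewrite -[X in _ --> X]addr0; apply: cvgD; first exact: cvg_cst.
rewrite -[X in _ --> X](mulr0 0).
under eq_fun do rewrite expr2.
by apply: cvgM; exact: cvg_harmonic.
Qed.

Let kern_cvg l x : (kern l n x)%:E @[n --> \oo] --> wsq l x.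
Proof.
rewrite /wsq; have [->|xl] := eqVneq x l.
  (* At [x = l] the approximants are [w l * (n + 1)^2], with limit [+oo], or 0 when [w l = 0]:
     exactly the convention for [0 * +oo]. *)
  rewrite subrr normr0 expr0n/= inve0; have [wl0|wl0] := eqVneq (w l) 0.
    rewrite wl0 mul0e; apply: cvg_near_cst; apply: nearW => n.
    by rewrite /kern wl0 mul0r.
  have wl : 0 < w l by rewrite lt_def wl0 w0.
  rewrite gt0_muley ?lte_fin//; apply/cvgeyPge => A; near=> n.
  rewrite lee_fin /kern subrr expr0n add0r exprVn invrK.
  apply: (@le_trans _ _ (w l * n.+1%:R)); last first.
    by rewrite ler_wpM2l// expr2 ler_peMr// ler1n.
  rewrite -ler_pdivrMl// mulrC; apply: (@le_trans _ _ n%:R); last by rewrite ler_nat.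
  by near: n; exact: nbhs_infty_ger.
have h : x - l != 0 by rewrite subr_eq0.
rewrite inver expf_eq0/= normr_eq0 (negbTE h) -EFinM.
apply: cvg_EFin; first exact: nearW.
apply: cvgM; first exact: cvg_cst.
by rewrite real_normK ?num_real//; exact: cvg_inv_denom.
Unshelve. all: by end_near. Qed.

Let measurable_wsq l : measurable_fun setT (wsq l).
Proof.
apply: (@emeasurable_fun_cvg _ _ _ _ (fun n x => (kern l n x)%:E)) => [n|x _].
  by apply/measurable_EFinP; exact: kern_meas.
exact: kern_cvg.
Qed.

Let wsq_ge0 l x : (0 <= wsq l x)%E.
Proof. by rewrite mule_ge0 ?lee_fin// inve_ge0 lee_fin sqr_ge0. Qed.

Let kern_nd l x : {homo (fun n => (kern l n x)%:E) : a b / (a <= b)%N >-> (a <= b)%E}.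
Proof.
move=> a b ab; rewrite lee_fin ler_wpM2l// lef_pV2 ?posrE ?kernel_denom_gt0//.
rewrite lerD2l lerXn2r ?nnegrE ?invr_ge0// lef_pV2 ?posrE//.
by rewrite ler_nat.
Qed.

Let kern_Im l n x :
  n.+1%:R * Im ((w x)%:C%C / (x%:C%C - (l +i* n.+1%:R^-1)%C)) = kern l n x.
Proof.
rewrite ImZ Im_kernel /kern [Re _]/= [Im _]/= mulrCA; congr (_ * _).
by rewrite mulrA divff ?mul1r// pnatr_eq0.
Qed.

Let int_kern l n : (\int[m]_x (kern l n x)%:E)%E =
  (n.+1%:R * Im (F (l +i* n.+1%:R^-1)%C))%:E.
Proof.
have e0 : 0 < Im (l +i* n.+1%:R^-1)%C by exact: npos.
have [_ ii] := cintegrable_stieltjes w0 wi e0.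
rewrite -[LHS](@fineK R); last first.
  apply: integrable_fin_num => //.
  apply: eq_integrable (integrableZl _ n.+1%:R ii) => // x _.
  by apply: (congr1 EFin); exact: kern_Im.
congr EFin; rewrite -[Im _]/(Rintegral _ _ _) -RintegralZl//.
by apply: eq_Rintegral => x _; rewrite -kern_Im.
Qed.

Lemma cvg_square_integral l :
  (n.+1%:R * Im (F (l +i* n.+1%:R^-1)%C))%:E @[n --> \oo] -->
    (\int[m]_x ((w x)%:E * (`|x - l| ^+ 2)%:E^-1))%E.
Proof.
rewrite -/(wsq l _) -/(sqi l).
rewrite (_ : (fun n => _) = (fun n => (\int[m]_x (kern l n x)%:E)%E)); last first.
  by apply/funext => n; rewrite int_kern.
rewrite (_ : sqi l = (\int[m]_(x in setT) limn (fun n => (kern l n x)%:E))%E); last first.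
  by apply: eq_integral => x _; apply/esym/cvg_lim => //; exact: kern_cvg.
apply: (@cvg_monotone_convergence _ _ _ m setT measurableT (fun n x => (kern l n x)%:E)).
- by move=> n; apply/measurable_EFinP; exact: kern_meas.
- by move=> n x _; rewrite lee_fin.
- by move=> x _; exact: kern_nd.
Qed.

Lemma le_square_integral l n :
  ((n.+1%:R * Im (F (l +i* n.+1%:R^-1)%C))%:E <=
    \int[m]_x ((w x)%:E * (`|x - l| ^+ 2)%:E^-1))%E.
Proof.
rewrite -int_kern; apply: ge0_le_integral => //.
- by move=> x _; rewrite lee_fin; exact: kern_ge0.
- by apply/measurable_EFinP; exact: kern_meas.
- exact: measurable_wsq.
- move=> x _; rewrite -/(wsq l x) -(cvg_lim _ (@kern_cvg l x))//.
  apply: lime_ge; first by apply/cvg_ex; eexists; exact: kern_cvg.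
  by exists n => // k nk; exact: kern_nd.
Qed.

Section finite.
Variable l : R.
Hypothesis sq_fin : (\int[m]_x ((w x)%:E * (`|x - l| ^+ 2)%:E^-1) < +oo)%E.

(* Finiteness of the integral forces the weight to vanish at [l] up to an
   m-null set, so [w] may be replaced by [w'] and no junk value [0^-1] occurs. *)
Let w' : R -> R := w \_ (~` [set l]).

Let w'l : w' l = 0.
Proof. by rewrite /w' patchE memNset//= => /(_ erefl). Qed.

Let w'E x : x != l -> w' x = w x.
Proof. by move=> /eqP xl; rewrite /w' patchE mem_set. Qed.

Let w'm : measurable_fun setT w'.
Proof.
apply/(measurable_restrictT _ _).1; last exact: measurable_funTS.
exact: measurableC.
Qed.

Let w'0 x : 0 <= w' x.
Proof. by rewrite /w' patchE; case: ifP. Qed.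

Let w'_le x : w' x <= w x.
Proof. by have [->|/w'E->//] := eqVneq x l; rewrite w'l. Qed.

Let w'i : m.-integrable setT (EFin \o w').
Proof.
apply: (le_integrable measurableT _ _ wi); first exact/measurable_EFinP.
by move=> x _; rewrite lee_fin !ger0_norm.
Qed.

Let sqi_int : m.-integrable setT (wsq l).
Proof.
apply/integrableP; split; first exact: measurable_wsq.
by under eq_integral do rewrite gee0_abs//.
Qed.

Let w'_ae : ae_eq m setT (EFin \o w) (EFin \o w').
Proof.
have := integrable_ae measurableT sqi_int.
apply: filterS => x /(_ I) fx _ /=; have [xl|/w'E->//] := eqVneq x l.
rewrite xl w'l; congr EFin; apply/eqP/negPn/negP => wl0.
have wl : 0 < w l by rewrite lt_def wl0 w0.
move: fx; rewrite xl /wsq subrr normr0 expr0n/= inve0 gt0_muley ?lte_fin//.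
Qed.

Let qr x : R := w' x / (x - l) ^+ 2.

Let qr_ge0 x : 0 <= qr x.
Proof. by rewrite divr_ge0// sqr_ge0. Qed.

Let qrm : measurable_fun setT qr.
Proof.
apply/measurable_EFinP.
apply: (@emeasurable_fun_cvg _ _ _ _ (fun n x => (w' x * ((x - l) ^+ 2 + n.+1%:R^-1 ^+ 2)^-1)%:E)) => [n|x _].
  apply/measurable_EFinP/measurable_funM => //; apply: continuous_measurable_fun => x.
  by apply: cvgV; [rewrite gt_eqF// kernel_denom_gt0|exact: continuous_kernel_denom].
apply: cvg_EFin; first exact: nearW.
have [->|xl] := eqVneq x l.
  by apply: cvg_near_cst; apply: nearW => n; rewrite /= /qr w'l !mul0r.
by apply: cvgM; [exact: cvg_cst|apply: cvg_inv_denom; rewrite subr_eq0].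
Qed.

Let qri : m.-integrable setT (EFin \o qr).
Proof.
apply: (le_integrable measurableT _ _ sqi_int); first exact/measurable_EFinP.
move=> x _ /=; rewrite ger0_norm// gee0_abs// /qr /wsq.
have [->|xl] := eqVneq x l; first by rewrite w'l mul0r; exact: wsq_ge0.
by rewrite w'E// inver expf_eq0/= normr_eq0 subr_eq0 (negbTE xl) -EFinM real_normK ?num_real.
Qed.

Let hE x : w x / (x - l) = w' x / (x - l).
Proof. by have [->|/w'E->//] := eqVneq x l; rewrite subrr invr0 !mulr0. Qed.

Let hm : measurable_fun setT (fun x => w x / (x - l)).
Proof.
rewrite (_ : (fun _ => _) = (fun x => (x - l) * qr x)).
  by apply: measurable_funM => //; exact: measurable_funB.
apply/funext => x; rewrite hE /qr; have [->|xl] := eqVneq x l.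
  by rewrite w'l !mul0r mulr0.
by field; rewrite subr_eq0.
Qed.

(** Dominated by [w + w / (x - l)^2], from [s <= 1 + s^2] with [s = 1 / |x - l|]. *)
Lemma integrable_boundary_kernel :
  m.-integrable setT (EFin \o (fun x => w x / (x - l))).
Proof.
apply: (le_integrable measurableT _ _ (integrableD measurableT wi qri)).
  exact/measurable_EFinP.
move=> x _; rewrite [leRHS](_ : _ = `|w x + qr x|%:E)// lee_fin.
rewrite (ger0_norm (addr_ge0 (w0 x) (qr_ge0 x))) hE.
have [->|xl] := eqVneq x l.
  by rewrite w'l mul0r normr0 addr_ge0.
rewrite /qr w'E// normrM ger0_norm// normfV -(real_normK (num_real (x - l))).
rewrite -exprVn -{2}[w x]mulr1 -mulrDr ler_wpM2l//.
have := sqr_ge0 (`|x - l|^-1 - 1); have : 0 <= `|x - l|^-1 by rewrite invr_ge0.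
by rewrite sqrrB mulr1 expr1n; lra.
Qed.

(** With [t = x - l], the kernels differ by [1 / (t - ie) - 1 / t = ie / (t (t - ie))], of modulus
    at most [e / t^2]; the constant is twice the finite square integral. *)
Lemma stieltjes_boundary_bound : exists2 C : R, 0 <= C & forall e : R, 0 < e ->
  normc (F (l +i* e)%C - (\int[m]_x (w x / (x - l)))%:C%C) <= C * e.
Proof.
exists (2 * \int[m]_x qr x); first by rewrite mulr_ge0// Rintegral_ge0.
move=> e e0.
have e0' : 0 < Im (l +i* e)%C by [].
have [Fr Fi] := cintegrable_stieltjes w0 wi e0'.
have [F'r F'i] := cintegrable_stieltjes w'0 w'i e0'.
have -> : F (l +i* e)%C = stieltjes m w' (l +i* e)%C.
  apply: complex_eqP; rewrite /stieltjes /cintegral [LHS]/= [RHS]/= /Rintegral;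
    congr fine; apply: ae_eq_integral => //.
  - exact: measurable_int Fr.
  - exact: measurable_int F'r.
  - apply: filterS w'_ae => x /(_ I)[+] _.
    by rewrite /= => ->.
  - exact: measurable_int Fi.
  - exact: measurable_int F'i.
  - apply: filterS w'_ae => x /(_ I)[+] _.
    by rewrite /= => ->.
have Ji : cintegrable m (fun x => (w x / (x - l))%:C%C).
  split; first exact: integrable_boundary_kernel.
  by apply: eq_integrable (integrable0 _ _).
have -> : (\int[m]_x (w x / (x - l)))%:C%C = cintegral m (fun x => (w x / (x - l))%:C%C).
  by apply: complex_eqP => //=; rewrite Rintegral_cst// mul0r.
have F'c : cintegrable m (fun x => (w' x)%:C%C / (x%:C%C - (l +i* e)%C)) by split.
rewrite /stieltjes -(cintegralB F'c Ji).
rewrite -mulrA [_ * e]mulrC -RintegralZl//.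
apply: normc_cintegral_le.
- under eq_fun do rewrite -(mulN1r (_%:C%C)).
  by apply: cintegrableD => //; exact: cintegrableZ.
- exact: (integrableZl _ _ qri).
- move=> x; rewrite hE /qr; have [->|xl] := eqVneq x l.
    by rewrite w'l !mul0r subrr normc0 mulr0.
  have t0 : x - l != 0 by rewrite subr_eq0.
  rewrite rmorphM -mulrBr normcM normc_real ger0_norm// mulrCA ler_wpM2l//.
  have z0 : x%:C%C - (l +i* e)%C != 0 by rewrite subz_neq0//= gt_eqF.
  have t0' : (x - l)%:C%C != 0 :> R[i] by rewrite eq_complex/= negb_and t0.
  have -> : (x%:C%C - (l +i* e)%C)^-1 - ((x - l)^-1)%:C%C =
      (0 +i* e)%C * ((x - l)%:C%C^-1 * (x%:C%C - (l +i* e)%C)^-1).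
    have -> : ((x - l)^-1)%:C%C = ((x - l)%:C%C)^-1 :> R[i] by rewrite fmorphV.
    have -> : (0 +i* e)%C = (x - l)%:C%C - (x%:C%C - (l +i* e)%C).
      by apply: complex_eqP => /=; ring.
    move: z0 t0'; generalize (x%:C%C - (l +i* e)%C) ((x - l)%:C%C) => z t z0 t0'. by field; rewrite z0 t0'.
  have -> : e / (x - l) ^+ 2 = e * (`|x - l|^-1 * `|x - l|^-1).
    by rewrite -invfM -expr2 real_normK ?num_real.
  rewrite normcM; have -> : normc (0 +i* e)%C = e.
    by rewrite /normc expr0n add0r sqrtr_sqr gtr0_norm.
  rewrite ler_wpM2l ?(ltW e0)// normcM normcV normc_real ler_wpM2l ?invr_ge0//.
  rewrite normcV lef_pV2 ?posrE ?normr_gt0// ?normc_gt0//.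
  apply: le_trans (ler_Re_normc _).
  by rewrite ReB_real.
Qed.

End finite.

End square_integral.

(** * The rank one perturbation relation *)

Section boundary.
Context {R : realType}.
Variable m : {measure set (measurableTypeR R) -> \bar R}.
Variable v : R -> R[i].
Implicit Types (l a e : R) (c : R[i]).
Let w x : R := normc (v x) ^+ 2.
Notation F := (stieltjes m w).

Lemma boundary_integral_eqP l c : boundary_integral_eq m v l c <->
  forall d : R, 0 < d -> exists2 e0 : R, 0 < e0 &
    forall e, 0 < e -> e < e0 -> normc (F (l +i* e)%C - c) <= d.
Proof.
split.
- move=> /(@cvgrPdist_le R[i] R[i]^o R (0^'+) _ _ c).1 H d d0.
  have d0' : 0 < d%:C%C :> R[i] by rewrite ltcR.
  have := H _ d0'; rewrite near_withinE => -[e0 /= e00 He].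
  exists e0 => // e ep ee0.
  have : ball_ Num.norm 0 e0 e by rewrite /= sub0r normrN gtr0_norm.
  move=> /He /(_ ep).
  by rewrite -lecR normc_distC; move=> h; exact: h.
- move=> H; apply: (@cvgrPdist_le R[i] R[i]^o R (0^'+) _ _ c).2 => d d0.
  (* Radii are elements of [R[i]], where positive means zero imaginary part and positive real
     part. *)
  have [dr d0'] : d = (Re d)%:C%C /\ 0 < Re d.
    by move: d d0 => [p q]; rewrite ltcE/= => /andP[/eqP -> p0].
  have [e0 e00 He] := H _ d0'.
  rewrite near_withinE; exists e0 => //= e /=; rewrite sub0r normrN => ee0 e0'.
  have := He e e0' (le_lt_trans (ler_norm _) ee0).
  by rewrite normc_distC -lecR -dr => h; exact: h.
Qed.

End boundary.

Section transfer.
Context {R : realType}.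
Implicit Types G Om F : R[i].

Lemma moebius_transfer G F Om : Om = (1 + G * F) / (G - F) -> G - F != 0 ->
  (F - G) * (Om + G) = - (1 + G ^+ 2).
Proof. by move=> -> h; field. Qed.

End transfer.

Lemma near_invS_le (R : realType) (d : R) : 0 < d ->
  \forall n \near \oo, n.+1%:R^-1 <= d.
Proof.
move=> d0; have /cvgrPdist_le/(_ _ d0) := @cvg_harmonic R.
apply: filterS => n; rewrite sub0r normrN; exact/le_trans/ler_norm.
Qed.

Section rank_one_perturbation.
Context {R : realType}.
Variable m : {measure set (measurableTypeR R) -> \bar R}.
Variable w : R -> R.
Hypothesis w0 : forall x, 0 <= w x.
Hypothesis wi : m.-integrable setT (EFin \o w).
Variable omega : {finite_measure set (measurableTypeR R) -> \bar R}.
Variable a : R.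
Notation F := (stieltjes m w).
Notation Om := (stieltjes omega (fun=> 1)).
Hypothesis OmE : forall z : R[i], 0 < Im z ->
  Om z = (1 + (a%:C%C - z) * F z) / ((a%:C%C - z) - F z).
Implicit Types (l e d C : R).

Definition boundary_value l := forall d, 0 < d -> exists2 e0 : R, 0 < e0 &
  forall e, 0 < e -> e < e0 -> normc (F (l +i* e)%C - (a - l)%:C%C) <= d.

Definition blowup l := forall C, exists2 e0 : R, 0 < e0 &
  forall e, 0 < e -> e < e0 -> C <= normc (Om (l +i* e)%C).

Let one_ge0 : forall x : R, 0 <= (fun=> 1 : R) x.
Proof. by []. Qed.

Let one_int : omega.-integrable setT (EFin \o (fun=> 1 : R)).
Proof. exact: finite_measure_integrable_cst. Qed.

Let G l e : R[i] := a%:C%C - (l +i* e)%C.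

Let transfer l e : 0 < e ->
  normc (F (l +i* e)%C - G l e) * normc (Om (l +i* e)%C + G l e) =
  normc (1 + G l e ^+ 2).
Proof.
move=> e0; have e0' : 0 < Im (l +i* e)%C by [].
rewrite -normcM (moebius_transfer (OmE e0')) ?normc_opp//.
(* The imaginary part of [G - F] is [- (e + Im F)], which is negative. *)
apply: Im_neq0; rewrite ImDc ImNc ImB_real lt_eqF//.
rewrite -opprD oppr_lt0 ltr_pwDl//.
exact: Im_stieltjes_ge0.
Qed.

Let normcG_sub l e : 0 < e -> normc (G l e - (a - l)%:C%C) = e.
Proof.
move=> e0; have -> : G l e - (a - l)%:C%C = (0 -i* e)%C.
  by apply: complex_eqP => /=; ring.
by rewrite /normc expr0n add0r sqrrN sqrtr_sqr gtr0_norm.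
Qed.

Let normcG l e : 0 < e -> normc (G l e) <= `|a - l| + e.
Proof.
move=> e0; rewrite -(subrK (a - l)%:C%C (G l e)) (le_trans (ler_normcD _ _))//.
by rewrite normcG_sub// normc_real addrC.
Qed.

Let le_normc1G l e : 0 < e -> normc (1 + G l e ^+ 2) <= 1 + (`|a - l| + e) ^+ 2.
Proof.
move=> e0; rewrite (le_trans (ler_normcD _ _))// normc1 lerD2l normcX.
by rewrite lerXn2r ?nnegrE ?normc_ge0 ?addr_ge0 ?normcG// ltW.
Qed.

(** The real part is [1 + (a - l)^2 - e^2], at least 3/4 for [e <= 1/2]. *)
Let ge_normc1G l e : 0 < e -> e <= 2^-1 -> 2^-1 <= normc (1 + G l e ^+ 2).
Proof.
move=> e0 e1; apply: le_trans (ler_Re_normc _); apply: le_trans (ler_norm _).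
have -> : Re (1 + G l e ^+ 2) = 1 + (a - l) ^+ 2 - e ^+ 2.
  by rewrite expr2 /G /=; ring.
by have := sqr_ge0 (a - l); nra.
Qed.

Let normcF_G l e : 0 < e ->
  normc (F (l +i* e)%C - G l e) <= normc (F (l +i* e)%C - (a - l)%:C%C) + e.
Proof.
move=> e0; have E : F (l +i* e)%C - G l e =
    (F (l +i* e)%C - (a - l)%:C%C) + ((a - l)%:C%C - G l e) by rewrite addrA subrK.
by rewrite E (le_trans (ler_normcD _ _))// lerD2l normc_distC normcG_sub.
Qed.

Lemma blowup_boundary_value l : blowup l -> boundary_value l.
Proof.
move=> bl d d0; set g := `|a - l|; pose K := 1 + (g + 1) ^+ 2.
have g0 : 0 <= g by exact: normr_ge0.
have K0 : 0 < K by rewrite ltr_pwDl// sqr_ge0.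
(* Subtracting [|G| <= g + 1] leaves [|Om + G| >= 2 * K / d], hence [|F - G| <= d / 2]; the other
   half of [d] pays for [|G - (a - l)| = e]. *)
have [e1 e10 H] := bl (g + 1 + 2 * K / d).
exists (Num.min e1 (Num.min 1 (d / 2))).
  by rewrite !lt_min e10 ltr01 divr_gt0.
move=> e e0; rewrite !lt_min => /and3P[ee1 el1 ed].
have {}H := H e e0 ee1; have T := transfer l e0.
have nG := normcG l e0; have n1 := le_normc1G l e0; rewrite -/g in nG n1.
have n1K : normc (1 + G l e ^+ 2) <= K.
  rewrite (le_trans n1)// lerD2l lerXn2r ?nnegrE; try lra.
have OG : 2 * K / d <= normc (Om (l +i* e)%C + G l e).
  have := ler_sub_normc (Om (l +i* e)%C) (- G l e); rewrite normc_opp opprK; lra.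
have FG : normc (F (l +i* e)%C - G l e) <= d / 2.
  rewrite -(ler_pM2r (_ : 0 < 2 * K / d)); last by rewrite !(mulr_gt0, invr_gt0).
  apply: (@le_trans _ _ K); last by rewrite le_eqVlt; apply/orP; left; apply/eqP; field; rewrite gt_eqF.
  by apply: le_trans n1K; rewrite -T ler_wpM2l// normc_ge0.
have -> : F (l +i* e)%C - (a - l)%:C%C =
    (F (l +i* e)%C - G l e) + (G l e - (a - l)%:C%C) by rewrite addrA subrK.
by rewrite (le_trans (ler_normcD _ _))// normcG_sub// [leRHS]splitr lerD// ltW.
Qed.

(** Used with [d] fixed to obtain blow-up, and with [d] proportional to [e] to detect atoms. *)
Let transfer_lower l e d : 0 < e -> e <= 2^-1 -> 0 < d ->
  normc (F (l +i* e)%C - (a - l)%:C%C) + e <= d ->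
  (2 * d)^-1 - (`|a - l| + e) <= normc (Om (l +i* e)%C).
Proof.
move=> e0 e2 d0 Fd; have T := transfer l e0.
have n1 := ge_normc1G l e0 e2; have nG := normcG l e0.
have FG := le_trans (normcF_G l e0) Fd.
have OG : (2 * d)^-1 <= normc (Om (l +i* e)%C + G l e).
  rewrite -(ler_pM2l d0) invfM mulrCA divff ?gt_eqF// mulr1.
  by rewrite (le_trans n1)// -T ler_wpM2r// normc_ge0.
by have := ler_normcD (Om (l +i* e)%C) (G l e); lra.
Qed.

Lemma boundary_value_blowup l : boundary_value l -> blowup l.
Proof.
move=> bv C; set g := `|a - l|; pose M := `|C| + g + 1.
have g0 : 0 <= g by exact: normr_ge0.
have M0 : 0 < M by have := normr_ge0 C; rewrite /M; lra.
(* Then [(2 * d)^-1 = M], and subtracting [g + e] from [M] still leaves at least [|C|]. *)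
pose d := (2 * M)^-1; have d0 : 0 < d by rewrite invr_gt0 mulr_gt0.
have d2 : 0 < d / 2 by rewrite divr_gt0.
have [e1 e10 H] := bv _ d2.
exists (Num.min e1 (Num.min 2^-1 (d / 2))).
  by rewrite !lt_min e10 invr_gt0 ltr0n divr_gt0.
move=> e e0; rewrite !lt_min => /and3P[ee1 el1 ed].
have {}H := H e e0 ee1.
have E : (2 * d)^-1 = M by rewrite /d; field; rewrite gt_eqF.
have Fd : normc (F (l +i* e)%C - (a - l)%:C%C) + e <= d by lra.
have := transfer_lower e0 (ltW el1) d0 Fd; rewrite E => h.
by apply: le_trans h; have := ler_norm C; rewrite /M -/g; lra.
Qed.

(** The Poisson kernel [e / ((x - l)^2 + e^2)] is at least [1 / (2 * e)] where [|x - l| <= e]. *)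
Lemma le_Im_stieltjes l e (B : set R) : measurable (B : set (measurableTypeR R)) ->
  0 < e -> (forall x, B x -> `|x - l| <= e) ->
  (omega B <= (2 * e * Im (Om (l +i* e)%C))%:E)%E.
Proof.
move=> mB e0 Be; have e0' : 0 < Im (l +i* e)%C by [].
have [_ ki] := cintegrable_stieltjes one_ge0 one_int e0'.
have kE x : Im ((1 : R)%:C%C / (x%:C%C - (l +i* e)%C)) = e / ((x - l) ^+ 2 + e ^+ 2).
  by rewrite ImZ Im_kernel mul1r.
have k0 x : 0 <= e / ((x - l) ^+ 2 + e ^+ 2).
  by rewrite divr_ge0 ?(ltW e0)// ltW// kernel_denom_gt0// gt_eqF.
have h : ((2 * e)^-1%:E * omega B <= (Im (Om (l +i* e)%C))%:E)%E.
  have -> : (Im (Om (l +i* e)%C))%:E = (\int[omega]_x (e / ((x - l) ^+ 2 + e ^+ 2))%:E)%E.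
    rewrite -[Im _]/(Rintegral _ _ _) /Rintegral fineK; last exact: integrable_fin_num ki.
    by apply: eq_integral => x _; rewrite kE.
  rewrite -integral_cst//.
  have mk : measurable_fun setT (fun x : R => (e / ((x - l) ^+ 2 + e ^+ 2))%:E).
    by have := measurable_int _ ki; apply: eq_measurable_fun => x _ /=; rewrite -kE.
  apply: (@le_trans _ _ (\int[omega]_(x in B) (e / ((x - l) ^+ 2 + e ^+ 2))%:E)%E).
    apply: ge0_le_integral => //.
    - by move=> x _; rewrite lee_fin invr_ge0 mulr_ge0// ltW.
    - exact: measurable_funTS.
    - move=> x Bx; rewrite lee_fin ler_pdivlMr ?kernel_denom_gt0 ?gt_eqF// mulrC.
      rewrite ler_pdivrMr ?mulr_gt0//.
      have := Be x Bx; have := normr_ge0 (x - l).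
      by rewrite -(real_normK (num_real (x - l))); nra.
  by apply: ge0_subset_integral => // x _; rewrite lee_fin.
have e2 : 0 < 2 * e by rewrite mulr_gt0.
have := lee_wpmul2l (_ : (0 <= (2 * e)%:E)%E) h; rewrite lee_fin (ltW e2) => /(_ isT).
by rewrite muleA -EFinM divff ?gt_eqF// mul1e.
Qed.

Lemma density_blowup l :
  (forall k : nat, exists n0, forall n, (n0 <= n)%N ->
    ((k%:R / 2 ^+ n)%:E < omega (dyadic_cell n (dyadic_index n l)))%E) -> blowup l.
Proof.
(* The 4 collects a factor 2 from [le_Im_stieltjes] and a factor 2 from rounding [e] down to a
   dyadic length, which exceeds [e / 2]. *)
move=> H C; have [k Ck] : exists k : nat, 4 * C <= k%:R.
  exists (Num.trunc (4 * `|C|)).+1; rewrite (le_trans _ (ltW (truncnS_gt _)))//.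
  by rewrite ler_wpM2l// ler_norm.
have [n0 Hn] := H k; exists (2 ^- n0); first by rewrite invr_gt0 exprn_gt0.
move=> e e0 en0.
have ex : exists n, 2 ^- n <= e.
  have h1 : 2^-1 < 1 :> R by rewrite invf_lt1// ltr1n.
  have [//|n] := @cvg_geometric_small R 2^-1 1 e _ h1 e0.
  by rewrite mulr1 exprVn; exists n.
have [n ne nmin] := ex_minnP ex.
have n0n : (n0 < n)%N.
  rewrite ltnNge; apply/negP => nn0; have : 2 ^- n0 <= 2 ^- n :> R.
    by rewrite lef_pV2 ?posrE ?exprn_gt0// ler_eXn2l// ltr1n.
  by lra.
(* Being above [n0], the level is a successor; minimality makes the cells one level coarser longer
   than [e]. *)
case: n n0n ne nmin => // n n0n ne nmin.
have en : e < 2 ^- n.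
  by rewrite ltNge; apply/negP => /nmin; rewrite ltnn.
have := @le_Im_stieltjes l e (dyadic_cell n.+1 (dyadic_index n.+1 l))
  (measurable_dyadic_cell _ _) e0.
have dist x : dyadic_cell n.+1 (dyadic_index n.+1 l) x -> `|x - l| <= e.
  by move=> /dyadic_cell_dist; rewrite distrC => /le_trans; apply.
move=> /(_ dist) h; have := lt_le_trans (Hn _ (ltnW n0n)) h; rewrite lte_fin => {}h.
apply: le_trans (ler_Im_normc _); apply: le_trans (ler_norm _).
have e2 : 0 < 2 * e by rewrite mulr_gt0.
rewrite -(ler_pM2l e2); apply: le_trans (ltW h).
have [C0|C0] := leP C 0.
  apply: (@le_trans _ _ 0); last by rewrite divr_ge0// exprn_ge0.
  by rewrite mulr_ge0_le0// ltW.
have p0 : 0 < 2 ^- n :> R by rewrite invr_gt0 exprn_gt0.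
rewrite exprS invfM mulrA; nra.
Qed.

Lemma atom_blowup l : omega [set l] != 0%E -> blowup l.
Proof.
move=> al C; set c := fine (omega [set l]).
have cE : omega [set l] = c%:E by rewrite fineK// fin_num_measure.
have c0 : 0 < c.
  by rewrite lt_def -eqe -cE al/= -lee_fin -cE measure_ge0.
have C1 : 0 < `|C| + 1 by rewrite ltr_wpDl.
exists (c / (2 * (`|C| + 1))); first by rewrite divr_gt0// mulr_gt0.
move=> e e0; rewrite ltr_pdivlMr ?mulr_gt0// => ec.
have := @le_Im_stieltjes l e [set l] (measurable_set1 _) e0.
move=> /(_ _); rewrite cE lee_fin => h; have {}h : c <= 2 * e * Im (Om (l +i* e)%C).
  by apply: h => x ->; rewrite subrr normr0 ltW.
apply: le_trans (ler_Im_normc _); apply: le_trans (ler_norm _).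
have := ler_norm C; nra.
Qed.

Lemma atom_square_integral l : omega [set l] != 0%E ->
  (\int[m]_x ((w x)%:E * (`|x - l| ^+ 2)%:E^-1) < +oo)%E.
Proof.
move=> al; set c := fine (omega [set l]).
have cE : omega [set l] = c%:E by rewrite fineK// fin_num_measure.
have c0 : 0 < c.
  by rewrite lt_def -eqe -cE al/= -lee_fin -cE measure_ge0.
set g := `|a - l|; have g0 : 0 <= g by exact: normr_ge0.
(* The atom gives [|Om| >= c / (2 * e)], and [|Om + G| >= c / (4 * e)] once [4 * e * (g + 1) <= c].
   The relation then yields [|F - G| <= K * e], hence [Im F / e <= K]. *)
pose K := 4 * (1 + (g + 1) ^+ 2) / c.
apply: (@le_lt_trans _ _ K%:E); last by rewrite ltry.
have /cvg_lim <- // := cvg_square_integral w0 wi (l := l).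
apply: lime_le; first by apply/cvg_ex; eexists; exact: (cvg_square_integral w0 wi (l := l)).
near=> n; rewrite lee_fin; set e := n.+1%:R^-1.
have e0 : 0 < e by rewrite invr_gt0.
have e1 : e <= 1 by rewrite invf_le1// ler1n.
have eg : e * (4 * (g + 1)) <= c.
  rewrite -ler_pdivlMr; last by lra.
  by rewrite /e; near: n; apply: near_invS_le; rewrite divr_gt0//; lra.
have := @le_Im_stieltjes l e [set l] (measurable_set1 _) e0.
move=> /(_ _); rewrite cE lee_fin => h; have {}h : c <= 2 * e * Im (Om (l +i* e)%C).
  by apply: h => x ->; rewrite subrr normr0 ltW.
have hO : c <= 2 * e * normc (Om (l +i* e)%C).
  apply: (le_trans h); rewrite ler_wpM2l ?mulr_ge0 ?(ltW e0)//.
  exact: le_trans (ler_norm _) (ler_Im_normc _).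
have nG := normcG l e0; rewrite -/g in nG.
have OG : c <= 4 * e * normc (Om (l +i* e)%C + G l e).
  have := ler_sub_normc (Om (l +i* e)%C) (- G l e); rewrite normc_opp opprK; nra.
have FG : Im (F (l +i* e)%C) + e <= normc (F (l +i* e)%C - G l e).
  apply: le_trans (ler_Im_normc _); apply: le_trans (ler_norm _).
  by rewrite ImDc ImNc ImB_real opprK.
have T := transfer l e0; have n1 := le_normc1G l e0; rewrite -/g in n1.
have n1K : normc (1 + G l e ^+ 2) <= 1 + (g + 1) ^+ 2.
  by rewrite (le_trans n1)// lerD2l lerXn2r ?nnegrE ?addr_ge0// ?(ltW e0)// lerD2l.
have Im0 : 0 <= Im (F (l +i* e)%C) by exact: Im_stieltjes_ge0.
have eE : n.+1%:R = e^-1 by rewrite invrK.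
rewrite eE mulrC ler_pdivrMr// /K mulrAC ler_pdivlMr//.
apply: (@le_trans _ _ (4 * e * normc (1 + G l e ^+ 2))); last first.
  by rewrite mulrAC ler_wpM2r ?(ltW e0)// ler_wpM2l.
rewrite -T mulrCA; apply: ler_pM => //; first exact: ltW.
by apply: le_trans FG; rewrite lerDl ltW.
Unshelve. all: by end_near. Qed.

(** The function [e / |x - l - ie|] is at most 1 and tends to 0 off [l], that is [omega]-almost
    everywhere: dominated convergence applies. *)
Lemma normc_stieltjes_atom0 l : omega [set l] = 0%E ->
  (n.+1%:R^-1 * normc (Om (l +i* n.+1%:R^-1)%C)) @[n --> \oo] --> (0 : R).
Proof.
move=> l0; pose e n : R := n.+1%:R^-1.
have e0 n : 0 < e n by rewrite invr_gt0.
pose h n x : R := e n * normc (x%:C%C - (l +i* e n)%C)^-1.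
have h0 n x : 0 <= h n x by rewrite mulr_ge0 ?normc_ge0 ?(ltW (e0 n)).
have h1 n x : h n x <= 1.
  by rewrite /h mulrC -ler_pdivlMr// mul1r; apply: normc_kernel_le; exact: e0.
have hm n : measurable_fun setT (h n).
  apply: measurable_funM => //; apply: measurable_normc; apply: cmeasurable_kernel.
  by rewrite gt_eqF//; exact: e0.
have hi n : omega.-integrable setT (EFin \o h n).
  apply: (le_integrable measurableT _ _ one_int); first by apply/measurable_EFinP; exact: hm.
  by move=> x _; rewrite lee_fin normr1 ger0_norm; [exact: h1|exact: h0].
have [||||| _ _ H] := @dominated_convergence _ _ _ omega setT measurableT
  (fun n x => (h n x)%:E) (fun=> 0%E) (EFin \o (fun=> 1 : R)).
- by move=> n; apply/measurable_EFinP; exact: hm.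
- exact: measurable_cst.
- exists [set l]; split; [exact: measurable_set1|exact: l0|].
  move=> x /= /not_implyP[_ xh]; apply: contrapT => /eqP xl; apply: xh.
  apply: cvg_EFin; first exact: nearW.
  apply/cvgrPdist_le => d d0.
  have t0 : 0 < `|x - l| by rewrite normr_gt0 subr_eq0.
  have : \forall n \near \oo, n.+1%:R^-1 <= d * `|x - l|.
    by apply: near_invS_le; rewrite mulr_gt0.
  apply: filterS => n nd; rewrite sub0r normrN.
  suff : `|h n x| <= d by [].
  rewrite ger0_norm; last exact: h0.
  rewrite /h normcV ler_pdivrMr ?normc_gt0 ?subz_neq0 ?gt_eqF//; last exact: e0.
  apply: (le_trans nd); rewrite ler_wpM2l ?(ltW d0)//.
  by apply: le_trans (ler_Re_normc _); rewrite ReB_real.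
- exact: one_int.
- by apply: aeW => x n _; rewrite lee_fin ger0_norm; [exact: h1|exact: h0].
have {}H : (2 * \int[omega]_x h n x) @[n --> \oo] --> (0 : R).
  rewrite -[X in _ --> X](mulr0 2); apply: cvgM; first exact: cvg_cst.
  by move: H; rewrite integral0 => /fine_cvg.
apply: (squeeze_cvgr _ (cvg_cst 0) H); apply: nearW => n.
rewrite mulr_ge0 ?normc_ge0//= -/(e n).
have e0' : 0 < Im (l +i* e n)%C by exact: e0.
have oi := cintegrable_stieltjes one_ge0 one_int e0'.
have -> : h n = fun x => e n * normc ((1 : R)%:C%C / (x%:C%C - (l +i* e n)%C)).
  by apply/funext => x; rewrite /h mul1r.
have ki : omega.-integrable setT
    (EFin \o (fun x => normc ((1 : R)%:C%C / (x%:C%C - (l +i* e n)%C)))).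
  apply: eq_integrable (integrableZl _ (e n)^-1 (hi n)) => // x _.
  have E : (e n)^-1 * h n x = normc ((1 : R)%:C%C / (x%:C%C - (l +i* e n)%C)).
    rewrite /h mulrA mulVf; last by rewrite gt_eqF//; exact: e0.
    by rewrite mul1r; congr normc; rewrite mul1r.
  exact: (congr1 EFin E).
rewrite RintegralZl// mulrCA ler_wpM2l ?(ltW (e0 n))//.
exact: (normc_cintegral_le oi ki).
Qed.

Lemma finite_square_integral_atom l :
  (\int[m]_x ((w x)%:E * (`|x - l| ^+ 2)%:E^-1) < +oo)%E ->
  \int[m]_x (w x / (x - l)) = a - l -> omega [set l] != 0%E.
Proof.
move=> sf J; apply/eqP => l0.
have [C C0 HC] := stieltjes_boundary_bound w0 wi sf; rewrite J in HC.
have /cvgrPdist_le H := normc_stieltjes_atom0 l0.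
have C1 : 0 < C + 1 by rewrite ltr_wpDl.
set g := `|a - l|; have g0 : 0 <= g by exact: normr_ge0.
(* [transfer_lower] at [(C + 1) * e] gives [e * |Om| >= 2 * d - e * (g + e)]. Once
   [e * (g + e) <= d / 2] this contradicts [e * |Om| <= d / 2], which holds eventually if [l] is not
   an atom. *)
pose d := (4 * (C + 1))^-1; have d0 : 0 < d by rewrite invr_gt0 mulr_gt0.
have {}H := H (d / 2) (divr_gt0 d0 (ltr0n _ 2)).
near \oo => n; have : `|0 - n.+1%:R^-1 * normc (Om (l +i* n.+1%:R^-1)%C)| <= d / 2.
  by near: n.
set e := n.+1%:R^-1; have e0 : 0 < e by rewrite invr_gt0.
rewrite sub0r normrN ger0_norm ?mulr_ge0 ?normc_ge0 ?(ltW e0)//.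
have e2 : e <= 2^-1 by rewrite /e; near: n; exact: near_invS_le.
have eg : e <= d / 2 / (g + 1).
  by rewrite /e; near: n; apply: near_invS_le; rewrite !divr_gt0// ltr_wpDl.
have := @transfer_lower l e ((C + 1) * e) e0 e2 (mulr_gt0 C1 e0).
rewrite mulrDl mul1r lerD2r => /(_ (HC e e0)).
rewrite -/g => h1 h2.
have : e * ((2 * (C * e + e))^-1 - (g + e)) <= d / 2.
  by apply: le_trans h2; rewrite ler_wpM2l ?(ltW e0).
have -> : (2 * (C * e + e))^-1 = 2 * d / e.
  have CE : C * e + e != 0.
    by rewrite gt_eqF// ltr_wpDl// mulr_ge0// ltW.
  by rewrite /d; field; rewrite CE !gt_eqF.
rewrite mulrBr mulrC divfK ?gt_eqF//.
move: eg; rewrite ler_pdivlMr ?ltr_wpDl// => eg; nra.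
Unshelve. all: by end_near. Qed.

(** By [stieltjes_boundary_bound] the limit of [F(l + ie)] exists here and equals the real
    integral. *)
Lemma finite_square_integral_boundary_value l :
  (\int[m]_x ((w x)%:E * (`|x - l| ^+ 2)%:E^-1) < +oo)%E ->
  boundary_value l <-> \int[m]_x (w x / (x - l)) = a - l.
Proof.
move=> sf; have [C C0 HC] := stieltjes_boundary_bound w0 wi sf.
have C1 : 0 < C + 1 by rewrite ltr_wpDl.
split=> [bv|J].
  apply/eqP; rewrite -subr_eq0 -normr_eq0; apply/eqP/le_anti; rewrite normr_ge0 andbT.
  apply/ler_addgt0Pr => d d0; rewrite add0r.
  have d2 : 0 < d / 2 by rewrite divr_gt0.
  have [e1 e10 H] := bv _ d2.
  pose e := Num.min (e1 / 2) (d / 2 / (C + 1)).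
  have e0 : 0 < e by rewrite lt_min !divr_gt0.
  have ee1 : e < e1 by rewrite gt_min; apply/orP; left; lra.
  have ed : C * e <= d / 2.
    have : e <= d / 2 / (C + 1) by rewrite ge_min lexx orbT.
    by rewrite ler_pdivlMr// => h; nra.
  have E : (\int[m]_x (w x / (x - l)) - (a - l))%:C%C =
      ((\int[m]_x (w x / (x - l)))%:C%C - F (l +i* e)%C) +
      (F (l +i* e)%C - (a - l)%:C%C) by rewrite addrA subrK rmorphB.
  rewrite -normc_real E (le_trans (ler_normcD _ _))// [leRHS]splitr lerD//.
    by rewrite normc_distC (le_trans (HC e e0)).
  exact: H.
move=> d d0; exists (d / (C + 1)); first by rewrite divr_gt0.
move=> e e0; rewrite ltr_pdivlMr// -J => ed; apply: (le_trans (HC e e0)); nra.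
Qed.

End rank_one_perturbation.

(** * Borel measurability of the sets in the theorem *)

Section measurability.
Context {R : realType}.
Variable m : {measure set (measurableTypeR R) -> \bar R}.
Variable w : R -> R.
Hypothesis w0 : forall x, 0 <= w x.
Hypothesis wi : m.-integrable setT (EFin \o w).
Variable a : R.
Notation F := (stieltjes m w).

Let closed_sublevel (f : R -> R) (c : R) : continuous f -> closed [set x | f x <= c].
Proof.
move=> cf; apply: (@preimage_closed _ _ f [set y | y <= c]); last exact: closed_le.
by move=> x _; exact: cf.
Qed.

(** For each [e] the condition on [l] is closed, and an intersection of closed sets over uncountably
    many [e] is still closed; only the two quantifiers over tolerances are made countable. *)
Lemma measurable_boundary_value :
  measurable ([set l | boundary_value m w a l] : set (measurableTypeR R)).
Proof.
pose f e l := normc (F (l +i* e)%C - (a - l)%:C%C).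
have cf e : 0 < e -> continuous (f e).
  move=> e0; apply: (@lipschitz_continuous_real _ _ (2 * mass m w / e ^+ 2 + 1)) => x y.
  have E : (F (x +i* e)%C - (a - x)%:C%C) - (F (y +i* e)%C - (a - y)%:C%C) =
      (F (x +i* e)%C - F (y +i* e)%C) + (x - y)%:C%C.
    by rewrite !rmorphB/=; ring.
  apply: (@le_trans _ _ (normc ((F (x +i* e)%C - F (y +i* e)%C) + (x - y)%:C%C))).
    rewrite -E ler_norml ler_sub_normc andbT lerNl opprB normc_distC.
    exact: ler_sub_normc.
  rewrite (le_trans (ler_normcD _ _))// mulrDl mul1r normc_real lerD2r.
  exact: stieltjes_lipschitz_line.
pose B k n := \bigcap_(e in [set e : R | 0 < e < n.+1%:R^-1]) [set l | f e l <= k.+1%:R^-1].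
have -> : [set l | boundary_value m w a l] = \bigcap_k \bigcup_n B k n.
  apply/seteqP; split => l /=.
    move=> bv k _; have [e0 e00 H] := bv k.+1%:R^-1 ltac:(by rewrite invr_gt0).
    have [n _ /(_ n (leqnn n)) ne] := near_invS_le e00.
    by exists n => // e /= /andP[ep en]; apply: H => //; exact: lt_le_trans en ne.
  move=> H d d0; have [k _ /(_ k (leqnn k)) kd] := near_invS_le d0.
  have [n _ Bn] := H k I; exists n.+1%:R^-1; first by rewrite invr_gt0.
  by move=> e e0 en; apply: le_trans kd; apply: Bn; rewrite /= e0 en.
apply: bigcapT_measurable => k; apply: bigcupT_measurable => n.
apply: closed_measurable; apply: closed_bigI => e /= /andP[e0 _].
exact/closed_sublevel/cf.
Qed.

(** Along [e = 1 / (n + 1)] the square integral is a supremum of functions continuous in [l], so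
    each of its sublevel sets is closed. *)
Lemma measurable_finite_square_integral :
  measurable ([set l | (\int[m]_x ((w x)%:E * (`|x - l| ^+ 2)%:E^-1) < +oo)%E]
    : set (measurableTypeR R)).
Proof.
have e0 n : 0 < n.+1%:R^-1 :> R by rewrite invr_gt0.
pose f n l : R := n.+1%:R * Im (F (l +i* n.+1%:R^-1)%C).
have -> : [set l | (\int[m]_x ((w x)%:E * (`|x - l| ^+ 2)%:E^-1) < +oo)%E] =
    \bigcup_(K : nat) \bigcap_n [set l | f n l <= K%:R].
  apply/seteqP; split => l /=.
    move=> sf; set s := (\int[m]_x _)%E in sf.
    have s0 : (0 <= s)%E.
      by apply: integral_ge0 => x _; rewrite mule_ge0 ?lee_fin// inve_ge0 lee_fin sqr_ge0.
    exists (Num.trunc (fine s)).+1 => // n _ /=.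
    rewrite -lee_fin (le_trans (le_square_integral w0 wi _ _))// -/s.
    by rewrite -[leLHS]fineK ?ge0_fin_numE// lee_fin ltW// truncnS_gt.
  move=> [K _ HK]; apply: (@le_lt_trans _ _ K%:R%:E); last by rewrite ltry.
  have /cvg_lim <- // := cvg_square_integral w0 wi (l := l).
  apply: lime_le.
    by apply/cvg_ex; eexists; exact: (cvg_square_integral w0 wi (l := l)).
  by apply: nearW => n; rewrite lee_fin; exact: HK.
apply: bigcupT_measurable => K; apply: closed_measurable.
apply: closed_bigI => n _; apply: closed_sublevel => x.
by apply: cvgM; [exact: cvg_cst|exact: continuous_Im_stieltjes].
Qed.

End measurability.

Lemma L2_integrable (R : realType) (m : {measure set (measurableTypeR R) -> \bar R})
  (v : R -> R[i]) : L2 m v ->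
  m.-integrable setT (EFin \o (fun x => normc (v x) ^+ 2)).
Proof.
move=> [mv]; rewrite /L2norm => Nv; apply/integrableP; split.
  by apply/measurable_EFinP/measurable_funX; exact: measurable_normc.
have : ('N[m]_2%:E[(fun x => (normc (v x))%:E)] `^ 2 < +oo)%E by rewrite poweR_lty.
rewrite poweR_Lnorm//; apply: le_lt_trans; rewrite le_eqVlt; apply/orP; left; apply/eqP.
apply: eq_integral => x _ /=; rewrite powR_mulrn ?normr_ge0//.
by rewrite normrX.
Qed.

Unset Implicit Arguments.

Theorem theorem3p4 (R : realType)
  (m : probability (measurableTypeR R) R) (hm : compactly_supported m)
  (a1 : R) (v : R -> R[i]) (hv : L2 m v) (hcyc : cyclic_vector m v)
  (omega : {finite_measure set (measurableTypeR R) -> \bar R})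
  (homega : compactly_supported omega)
  (hstieltjes : forall z : R[i], complex.Im z != 0 ->
     cintegral omega (fun l => (l%:C%C - z)^-1) =
     (1 + (a1%:C%C - z) * L2inner m v (resolvent z v)) /
     ((a1%:C%C - z) - L2inner m v (resolvent z v))) :
  (forall omega_ac omega_s : {measure set (measurableTypeR R) -> \bar R},
     lebesgue_decomposition omega omega_ac omega_s ->
     minimal_support omega_s (S_s m v a1) /\
     minimal_support (remove_atoms omega_s) (S_sc m v a1)) /\
  S_pp m v a1 = atoms omega.
Proof.
pose w x : R := normc (v x) ^+ 2.
have w0 x : 0 <= w x by exact: sqr_ge0.
have wi : m.-integrable setT (EFin \o w) by exact: L2_integrable.
have OmE z : 0 < Im z -> stieltjes omega (fun=> 1) z =
    (1 + (a1%:C%C - z) * stieltjes m w z) / ((a1%:C%C - z) - stieltjes m w z).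
  (* The inner product conjugates its first factor, so its integrand is [|v|^2 / (x - z)]. *)
  move=> z0; have -> : stieltjes m w z = L2inner m v (resolvent z v).
    apply: eq_cintegral => x; rewrite /resolvent mulrCA [LHS]mulrC; congr (_ * _).
    rewrite /w; case: (v x) => p q /=; apply: complex_eqP => /=.
      by rewrite sqr_sqrtr ?addr_ge0 ?sqr_ge0//; ring.
    by ring.
  rewrite -hstieltjes ?gt_eqF//; apply: eq_cintegral => x.
  by rewrite mul1r.
have S_sE : S_s m v a1 = [set l | boundary_value m w a1 l].
  by apply/seteqP; split => l /boundary_integral_eqP.
have mS : measurable (S_s m v a1 : set (measurableTypeR R)).
  by rewrite S_sE; exact: measurable_boundary_value.
have sqE l : square_integral m v l = (\int[m]_x ((w x)%:E * (`|x - l| ^+ 2)%:E^-1))%E by [].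
have S_ppE : S_pp m v a1 = S_s m v a1 `&` [set l | (square_integral m v l < +oo)%E].
  apply/seteqP; split => l /=.
    move=> [J sf]; split => //; rewrite S_sE /=.
    apply/(finite_square_integral_boundary_value w0 wi a1 sf).
    by rewrite /Rintegral J.
  move=> [Sl sf]; split => //; move: Sl; rewrite S_sE /=.
  move=> /(finite_square_integral_boundary_value w0 wi a1 sf) <-.
  by rewrite /Rintegral fineK//; apply: integrable_fin_num => //; exact: integrable_boundary_kernel.
have atomsE : S_pp m v a1 = atoms omega.
  rewrite S_ppE S_sE; apply/seteqP; split => l /=.
    move=> [bv sf]; rewrite /atoms /=.
    apply: (finite_square_integral_atom w0 wi OmE sf).
    exact/(finite_square_integral_boundary_value w0 wi a1 sf).
  move=> al; split; first exact: (blowup_boundary_value w0 OmE (atom_blowup al)).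
  exact: (atom_square_integral w0 wi OmE al).
split; last exact: atomsE.
move=> omega_ac omega_s [dec ac [N [mN N0 sN]]].
(* This settles both minimality claims, as the subsets they concern all lie in [S_s]. *)
have Snull : lebesgue_measure (S_s m v a1) = 0%E.
  apply: (@stieltjes_blowup_null R omega (fun=> 1)) => //.
    exact: finite_measure_integrable_cst.
  move=> x; rewrite S_sE => bv C; have bl := boundary_value_blowup w0 OmE bv.
  have [e0 e00 H] := bl C; have [n _ Hn] := near_invS_le (divr_gt0 e00 (ltr0n _ 2)).
  exists n => k nk; apply: H; first by rewrite invr_gt0.
  by apply: (le_lt_trans (Hn k nk)); lra.
(* The density argument is run for [omega] itself: off [S_s] there is no blow-up, so the dyadic
   densities of [omega] do not tend to infinity there, and the null set [N] carries no mass outside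
   [S_s]. *)
have omega_S : omega (N `&` ~` S_s m v a1) = 0%E.
  apply: dyadic_density_null.
  - by apply: measurableI => //; exact: measurableC.
  - apply/eqP; rewrite -measure_le0 -N0; apply: le_measure; rewrite ?inE//.
    by apply: measurableI => //; exact: measurableC.
  - move=> l [_ Sl]; apply: contrapT => H; apply: Sl; rewrite S_sE /=.
    apply: (blowup_boundary_value w0 OmE); apply: density_blowup => k.
    apply: contrapT => Hk; apply: H; exists k => n0; apply: contrapT => Hn.
    apply: Hk; exists n0 => n n0n; rewrite ltNge; apply/negP => le.
    by apply: Hn; exists n.
have mSC : measurable (~` S_s m v a1 : set (measurableTypeR R)) by exact: measurableC.
have mSN : measurable (N `&` ~` S_s m v a1 : set (measurableTypeR R)).
  exact: measurableI.
have sS : omega_s (~` S_s m v a1) = 0%E.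
  have sNS : omega_s (N `&` ~` S_s m v a1) = 0%E.
    by apply/eqP; rewrite -measure_le0 -omega_S dec// leeDr.
  apply/eqP; rewrite -measure_le0.
  apply: (@le_trans _ _ (omega_s ((N `&` ~` S_s m v a1) `|` ~` N))).
    apply: le_measure; rewrite ?inE//.
      by apply: measurableU => //; exact: measurableC.
    by move=> x Sx; have [Nx|Nx] := pselect (N x); [left|right].
  have : (omega_s ((N `&` ~` S_s m v a1) `|` ~` N) <=
      omega_s (N `&` ~` S_s m v a1) + omega_s (~` N))%E.
    by apply: measureU2 => //; exact: measurableC.
  by rewrite sNS sN adde0.
(* Points are Lebesgue null, so [omega_s] and [omega] have the same atoms. *)
have acatom l : omega_ac [set l] = 0%E.
  by apply: ((null_content_dominatesP _ _).1 ac) => //; exact: lebesgue_measure_set1.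
have satomsE : atoms omega_s = S_pp m v a1.
  by rewrite atomsE; apply/seteqP; split => l; rewrite /atoms /= dec// acatom add0e.
have mpp : measurable (S_pp m v a1 : set (measurableTypeR R)).
  by rewrite S_ppE; apply: measurableI => //; exact: measurable_finite_square_integral.
have S_scE : S_sc m v a1 = S_s m v a1 `\` S_pp m v a1.
  rewrite S_ppE; apply/seteqP; split => l /=.
    by move=> [Sl sq]; split => // -[_]; rewrite /= sq ltxx.
  move=> [Sl nsq]; split => //; apply/eqP; rewrite -leye_eq leNgt.
  by apply/negP => sq; apply: nsq.
have sub S' : S' `<=` S_s m v a1 -> measurable (S' : set (measurableTypeR R)) ->
    lebesgue_measure S' = 0%E.
  move=> S'S mS'; apply/eqP; rewrite -measure_le0 -Snull.
  by apply: le_measure; rewrite ?inE.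
split; split.
- by split.
- by move=> S' mS' S'S _; exact: sub.
- split; first by rewrite S_scE; exact: measurableD.
  (* [S_s] and [S_sc] differ by [S_pp], the set of atoms, which [remove_atoms] discards; so the
     support property of [omega_s] carries over. *)
  have E : ~` S_sc m v a1 `\` S_pp m v a1 = ~` S_s m v a1 `\` S_pp m v a1.
    rewrite S_scE; apply/seteqP; split => l /= [nS npp]; split => // Sl.
      by apply: nS; split.
    by case: Sl => /nS.
  rewrite /remove_atoms satomsE E; apply/eqP; rewrite -measure_le0 -sS.
  apply: le_measure; rewrite ?inE//; first exact: measurableD.
- move=> S' mS' S'S _; apply: sub => //.
  by apply: (subset_trans S'S); rewrite S_scE => l [].
Qed.
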